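(* For any $n\ge 2$ and $\boldsymbol\lambda=(\lambda_1,\lambda_2,\lambda_3)\in\mathcal A_3(n+1)$ the assignments $s'_i\mapsto w_\circ^{J_i(\boldsymbol\lambda)}$, $i\in\{1,2\}$, define an injective homomorphism of Hecke monoids $\psi_{\boldsymbol\lambda}:(W(A_2),\star)\to(W(A_n),\star)$, which is parabolic if and only if $\boldsymbol\lambda=(n-1,1,1)$. Conversely, if $\phi:(W(A_2),\star)\to(W(A_n),\star)$ is an injective, connected and fully supported homomorphism of Hecke monoids then, up to compositions with diagram automorphisms, $\phi=\psi_{\boldsymbol\lambda}$ for some $\boldsymbol\lambda\in\mathcal A_3(n+1)$.
   Context: For integers $a,b$ write $[a,b]=\{i\in\mathbb Z: a\le i\le b\}$. $A_n$ denotes the Coxeter matrix over $[1,n]$ with $m_{i,i+1}=3$ and $m_{ij}=2$ for $|i-j|>1$. For a Coxeter matrix $M=(m_{ij})$ over a finite set $I$, the Hecke monoid $(W(M),\star)$ is generated by $s_i$, $i\in I$, subject to $s_i\star s_i=s_i$ and $s_i\star s_j\star\cdots=s_j\star s_i\star\cdots$ ($m_{ij}$ factors on each side) for $i\neq j$ with $m_{ij}<\infty$; its underlying set is identified with the Coxeter group $W(M)$ (a reduced word being sent to the $\star$-product of its letters). For $J\subset I$, $W_J(M)$ is the subgroup generated by $s_j$, $j\in J$; $\mathscr F(M)$ is the set of $J\subset I$ with $W_J(M)$ finite, and for such $J$, $w_\circ^J$ is the longest element of $W_J(M)$. For $J\subset K\in\mathscr F(M)$, $w_{J;K}=w_\circ^Jw_\circ^K$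 (product in the Coxeter group). Generators of the domain are denoted $s'_i$. Homomorphisms of monoids preserve identity elements. For a homomorphism of Hecke monoids $\phi:(W(M'),\star)\to(W(M),\star)$, with $M'$ over $I'$ and $M$ over $I$, let $[\phi](i)$ be the support of $\phi(s'_i)$ (the set of indices occurring in a reduced expression) and $[\phi](J)=\bigcup_{j\in J}[\phi](j)$. $\phi$ is: fully supported if $[\phi](I')=I$; connected if $[\phi](J)$ is a connected subset of $I$ for every connected $J\subset I'$, where a subset is connected if it induces a connected subgraph of the Coxeter graph (vertices $i,j$ joined iff $m_{ij}>2$); parabolic if for each $K'\in\mathscr F(M')$ and each $J'\subset K'$ there exists $J\subset[\phi](K')$ with $\phi(w_{J';K'})=w_{J;[\phi](K')}$. A diagram automorphism is the automorphism induced by a permutation $\sigma$ of $I$ with $m_{\sigma(i)\sigma(j)}=m_{ij}$; the non-trivial one for $A_n$ is $s_i\mapsto s_{n+1-i}$. ''Up to compositions with diagram automorphisms'' refers to diagram automorphisms of the domain and the codomain. $\mathcal A_3(m)=\{(\lambda_1,\lambda_2,\lambda_3)\in\mathbb Z_{>0}^3:\lambda_1\ge\lambda_2\ge\lambda_3,\ \lambda_1+\lambda_2+\lambda_3=m\}$. For $\boldsymbol\lambda=(\lambda_1,\lambda_2,\lambda_3)\in\mathbb Z^3_{>0}$ put $J_1(\boldsymbol\lambda)=[1,\lambda_1+\lambda_3-1]$ and $J_2(\boldsymbol\lambda)=[\lambda_3+1,\lambda_1+\lambda_2+\lambda_3-1]$. *)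

(* Defs.v *)
From HB Require Import structures.
From mathcomp Require Import all_boot all_fingroup.
From mathcomp Require Import generic_quotient boolp classical_sets cardinality.

Set Implicit Arguments.
Unset Strict Implicit.
Unset Printing Implicit Defensive.

Local Open Scope group_scope.
Local Open Scope quotient_scope.

Inductive congr_closure (T : Type) (R : seq T -> seq T -> Prop) :
    seq T -> seq T -> Prop :=
| congr_base u v : R u v -> congr_closure R u v
| congr_refl u : congr_closure R u u
| congr_sym u v : congr_closure R u v -> congr_closure R v u
| congr_trans v u w :
    congr_closure R u v -> congr_closure R v w -> congr_closure R u w
| congr_cat u u' v v' :
    congr_closure R u u' -> congr_closure R v v' ->
    congr_closure R (u ++ v) (u' ++ v').

Section Presented.
Variables (T : choiceType) (R : seq T -> seq T -> Prop).

Definition word_eq : rel (seq T) := fun u v => `[< congr_closure R u v >].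

Lemma word_eq_equiv : equiv_class_of word_eq.
Proof.
split.
- by move=> u; apply/asboolP; apply: congr_refl.
- by move=> u v; apply/asboolP/asboolP; apply: congr_sym.
- move=> v u w /asboolP uv /asboolP vw; apply/asboolP.
  exact: congr_trans uv vw.
Qed.

Canonical word_eq_equiv_rel := EquivRelPack word_eq_equiv.

Definition presented := {eq_quot word_eq_equiv_rel}.

HB.instance Definition _ := Choice.on presented.

Definition word_class (u : seq T) : presented := \pi_{eq_quot _} u.

Lemma word_classP u v : word_class u = word_class v <-> congr_closure R u v.
Proof.
by split=> [/eqmodP/asboolP | uv] //; apply/eqmodP/asboolP.
Qed.

Definition word_repr (x : presented) : seq T :=
  @repr _ {eq_quot word_eq_equiv_rel} x.

Lemma word_reprK : cancel word_repr word_class.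
Proof. by move=> x; rewrite /word_class /word_repr reprK. Qed.

Lemma word_repr_congr u : congr_closure R (word_repr (word_class u)) u.
Proof. by apply/word_classP; rewrite word_reprK. Qed.

Definition presented_mul (x y : presented) : presented :=
  word_class (word_repr x ++ word_repr y).

Lemma presented_mulE u v :
  presented_mul (word_class u) (word_class v) = word_class (u ++ v).
Proof. by apply/word_classP; apply: congr_cat; apply: word_repr_congr. Qed.

Lemma presented_mulA : associative presented_mul.
Proof.
move=> x y z; rewrite -[x]word_reprK -[y]word_reprK -[z]word_reprK.
by rewrite !presented_mulE catA.
Qed.

Lemma presented_mul1 : left_id (word_class [::]) presented_mul.
Proof. by move=> x; rewrite -[x]word_reprK presented_mulE. Qed.

Lemma presented_mulr1 : right_id (word_class [::]) presented_mul.
Proof. by move=> x; rewrite -[x]word_reprK presented_mulE cats0. Qed.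

HB.instance Definition _ :=
  isMonoid.Build presented presented_mulA presented_mul1 presented_mulr1.

Lemma word_class_cat u v :
  word_class (u ++ v) = word_class u * word_class v.
Proof. by rewrite -presented_mulE. Qed.

End Presented.

(* [None] stands for an infinite entry. *)
Record coxeter_matrix (I : finType) := CoxeterMatrix {
  cox_entry :> I -> I -> option nat;
  cox_diag : forall i, cox_entry i i = Some 1%N;
  cox_sym : forall i j, cox_entry i j = cox_entry j i;
  cox_offdiag : forall i j m, i != j -> cox_entry i j = Some m -> (1 < m)%N
}.

Definition alternating (I : Type) (i j : I) (m : nat) : seq I :=
  mkseq (fun k => if odd k then j else i) m.

Section CoxeterHecke.
Variables (I : finType) (M : coxeter_matrix I).

Inductive coxeter_rel : seq I -> seq I -> Prop :=
| coxeter_sq i : coxeter_rel [:: i; i] [::]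
| coxeter_braid i j m : i != j -> M i j = Some m ->
    coxeter_rel (alternating i j m) (alternating j i m).

Inductive hecke_rel : seq I -> seq I -> Prop :=
| hecke_idem i : hecke_rel [:: i; i] [:: i]
| hecke_braid i j m : i != j -> M i j = Some m ->
    hecke_rel (alternating i j m) (alternating j i m).

Definition coxeter := presented coxeter_rel.
Definition hecke := presented hecke_rel.

HB.instance Definition _ := Monoid.on coxeter.
HB.instance Definition _ := Monoid.on hecke.

Definition cox_word (u : seq I) : coxeter := word_class coxeter_rel u.
Definition hecke_word (u : seq I) : hecke := word_class hecke_rel u.
Definition cox_gen (i : I) : coxeter := cox_word [:: i].
Definition hecke_gen (i : I) : hecke := hecke_word [:: i].

Lemma rev_alternating (i j : I) m :
  rev (alternating i j m) =
  if odd m then alternating i j m else alternating j i m.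
Proof.
apply: (@eq_from_nth _ i) => [|k].
  by rewrite size_rev; case: ifP; rewrite !size_mkseq.
rewrite size_rev size_mkseq => lt_km.
rewrite nth_rev size_mkseq // nth_mkseq; last first.
  by rewrite ltn_subrL (leq_ltn_trans _ lt_km).
rewrite oddB //=.
by case: (odd m); rewrite nth_mkseq //=; case: (odd k).
Qed.

Lemma coxeter_rev u v : congr_closure coxeter_rel u v ->
  congr_closure coxeter_rel (rev u) (rev v).
Proof.
elim=> {u v} [u v|u|u v _ IH|v u w _ IH1 _ IH2|u u' v v' _ IH1 _ IH2].
- case=> [i|i j m neq_ij Mij]; first by apply: congr_base; left.
  rewrite !rev_alternating; case: ifP => _.
    by apply: congr_base; right.
  by apply: congr_sym; apply: congr_base; right.
- exact: congr_refl.
- exact: congr_sym.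
- exact: congr_trans IH1 IH2.
- by rewrite !rev_cat; apply: congr_cat.
Qed.

Definition coxeter_inv (x : coxeter) : coxeter :=
  cox_word (rev (word_repr x)).

Lemma coxeter_invE u : coxeter_inv (cox_word u) = cox_word (rev u).
Proof. by apply/word_classP/coxeter_rev/word_repr_congr. Qed.

Lemma cox_word_revr u : cox_word (u ++ rev u) = 1.
Proof.
apply/word_classP; elim: u => [|i u IH]; first exact: congr_refl.
rewrite rev_cons -cats1 -cat1s -catA (catA u).
apply: (congr_trans (v := [:: i] ++ [::] ++ [:: i])); last first.
  by apply: congr_base; left.
by do !apply: congr_cat => //; apply: congr_refl.
Qed.

Lemma coxeter_mulV : right_inverse (1 : coxeter) coxeter_inv *%g.
Proof.
move=> x; rewrite -[x](word_reprK (R := coxeter_rel)) coxeter_invE.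
by rewrite -word_class_cat; apply: cox_word_revr.
Qed.

Lemma coxeter_Vmul : left_inverse (1 : coxeter) coxeter_inv *%g.
Proof.
move=> x; rewrite -[x](word_reprK (R := coxeter_rel)) coxeter_invE.
rewrite -word_class_cat -[X in _ ++ X]revK; exact: cox_word_revr.
Qed.

HB.instance Definition _ := hasInv.Build coxeter coxeter_inv.
HB.instance Definition _ := Monoid_isGroup.Build coxeter coxeter_Vmul coxeter_mulV.

Definition reduced (u : seq I) : Prop :=
  forall v, cox_word v = cox_word u -> (size u <= size v)%N.

Lemma ex_reduced (w : coxeter) : exists u, cox_word u = w /\ reduced u.
Proof.
have exP : exists n, `[< exists u, cox_word u = w /\ size u = n >].
  exists (size (word_repr w)); apply/asboolP; exists (word_repr w).
  by rewrite /cox_word word_reprK.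
case: (ex_minnP exP) => n /asboolP[u [uw <-]] minn.
exists u; split=> // v vu; apply: minn; apply/asboolP; exists v.
by rewrite vu uw.
Qed.

Definition reduced_word (w : coxeter) : seq I := sval (cid (ex_reduced w)).

Definition cox_length (w : coxeter) : nat := size (reduced_word w).

(* The identification of the underlying set of the Hecke monoid with W(M); the
   result does not depend on the reduced word chosen, by Matsumoto's theorem. *)
Definition to_hecke (w : coxeter) : hecke := hecke_word (reduced_word w).

Definition hecke_supp (x : hecke) : {set I} :=
  [set i | `[< exists u, [/\ reduced u, hecke_word u = x & i \in u] >]]%SET.

Definition parabolic_subgroup (J : {set I}) : set coxeter :=
  [set w | forall S : {pred coxeter}, group_closed S ->
     (forall j, j \in J -> cox_gen j \in S) -> w \in S]%classic.

Definition finite_type (J : {set I}) : Prop :=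
  finite_set (parabolic_subgroup J).

(* Meaningful only when J is of finite type. *)
Definition longest (J : {set I}) : coxeter :=
  xget 1 [set w | parabolic_subgroup J w /\
    forall v, parabolic_subgroup J v -> (cox_length v <= cox_length w)%N]%classic.

Definition rel_longest (J K : {set I}) : coxeter := longest J * longest K.

Definition cox_edge : rel I :=
  fun i j => if M i j is Some m then (2 < m)%N else true.

Definition connected_set (J : {set I}) : bool :=
  [forall i in J, forall j in J,
     connect [rel x y | [&& x \in J, y \in J & cox_edge x y]] i j].

Definition diagram_automorphism
    (d : UMagmaMorphism.type hecke hecke) : Prop :=
  exists s : {perm I}, (forall i j, M (s i) (s j) = M i j) /\
    forall i, d (hecke_gen i) = hecke_gen (s i).

End CoxeterHecke.

Notation hecke_hom M' M := (UMagmaMorphism.type (hecke M') (hecke M)).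

Section Homomorphisms.
Variables (I' I : finType) (M' : coxeter_matrix I') (M : coxeter_matrix I).
Variable phi : hecke_hom M' M.

Definition hom_supp (J : {set I'}) : {set I} :=
  \bigcup_(j in J) hecke_supp (phi (hecke_gen M' j)).

Definition fully_supported : Prop := hom_supp [set: I'] = [set: I].

Definition connected_hom : Prop :=
  forall J : {set I'}, connected_set M' J -> connected_set M (hom_supp J).

(* [finite_type M (hom_supp K')] is implicit in the notation w_{J;[phi](K')}. *)
Definition parabolic_hom : Prop :=
  forall K' : {set I'}, finite_type M' K' ->
  forall J' : {set I'}, J' \subset K' ->
  finite_type M (hom_supp K') /\
  exists J : {set I}, J \subset hom_supp K' /\
    phi (to_hecke (rel_longest M' J' K')) =
      to_hecke (rel_longest M J (hom_supp K')).

End Homomorphisms.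

(* The node i of A_n (1 <= i <= n) is represented by the ordinal i - 1. *)
Definition A_entry (n : nat) (i j : 'I_n) : option nat :=
  Some (if i == j then 1%N
        else if (i.+1 == j) || (j.+1 == i) then 3 else 2).

Lemma A_diag n (i : 'I_n) : A_entry i i = Some 1%N.
Proof. by rewrite /A_entry eqxx. Qed.

Lemma A_sym n (i j : 'I_n) : A_entry i j = A_entry j i.
Proof. by rewrite /A_entry eq_sym orbC. Qed.

Lemma A_offdiag n (i j : 'I_n) m :
  i != j -> A_entry i j = Some m -> (1 < m)%N.
Proof. by rewrite /A_entry => /negPf-> [<-]; case: ifP. Qed.

Definition A_ (n : nat) : coxeter_matrix 'I_n :=
  CoxeterMatrix (@A_diag n) (@A_sym n) (@A_offdiag n).

(* The set of nodes [a, b] of A_n, with the nodes numbered from 1. *)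
Definition A_interval (n a b : nat) : {set 'I_n} :=
  [set i : 'I_n | a <= i.+1 <= b]%SET.

Definition partitions3 (m : nat) (l : nat * nat * nat) : bool :=
  let: (l1, l2, l3) := l in
  [&& l2 <= l1, l3 <= l2, 0 < l3 & l1 + l2 + l3 == m]%N.

(* J_1(lambda) for i = 0 and J_2(lambda) for i = 1. *)
Definition J_ (n : nat) (l : nat * nat * nat) (i : 'I_2) : {set 'I_n} :=
  let: (l1, l2, l3) := l in
  if i == ord0 then A_interval n 1 (l1 + l3 - 1)
  else A_interval n (l3 + 1) (l1 + l2 + l3 - 1).

(* A homomorphism is determined by its values on the generators, so this
   characterizes psi_lambda. *)
Definition is_psi (n : nat) (l : nat * nat * nat)
    (psi : hecke_hom (A_ 2) (A_ n)) : Prop :=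
  forall i : 'I_2,
    psi (hecke_gen (A_ 2) i) = to_hecke (longest (A_ n) (J_ n l i)).

(* Main.v *)
Require Import Defs.
From HB Require Import structures.
From mathcomp Require Import all_boot all_fingroup.
From mathcomp Require Import boolp classical_sets cardinality.
From mathcomp Require Import zify.

(* W(A_n) acts on the sequences of values at the positions 0, ..., n: the Coxeter
   generator i exchanges the entries i and i+1, the Hecke generator i sorts them in
   decreasing order.  By Matsumoto's theorem both actions on the identity sequence
   are faithful, so an element of the Hecke monoid is known from its sequence, and
   multiplying by w_o^J sorts each block of J.

   With A = l1, B = l2, C = l3 the two images of the generators sort the first A + C,
   respectively the last A + B, of the n + 1 positions.  Sorting first-last-first sorts
   everything iff B <= A, and last-first-last iff C <= A; the image of s_1 s_2 is of the
   form w_J w_o only if B = C = 1.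

   Conversely an idempotent of the Hecke monoid is w_o^J with J its support.  Two
   connected sets covering the diagram, neither of them everything, are an initial and
   a final segment, and the braid relation gives B <= A and C <= A; the order of B and C
   is adjusted by the flips of the two diagrams. *)

Set Implicit Arguments.
Unset Strict Implicit.
Unset Printing Implicit Defensive.

(** * Reduced words *)

Definition adj_transp (i k : nat) : nat :=
  if k == i then i.+1 else if k == i.+1 then i else k.

Definition swap (i : nat) (f : nat -> nat) : nat -> nat :=
  fun k => f (adj_transp i k).

Definition bubble (i : nat) (f : nat -> nat) : nat -> nat :=
  if f i < f i.+1 then swap i f else f.

Lemma adj_transpL i : adj_transp i i = i.+1.
Proof. by rewrite /adj_transp eqxx. Qed.

Lemma adj_transpR i : adj_transp i i.+1 = i.
Proof. by rewrite /adj_transp eqxx; case: ifP => // /eqP; lia. Qed.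

Lemma adj_transpD i k : k != i -> k != i.+1 -> adj_transp i k = k.
Proof. by rewrite /adj_transp => /negPf-> /negPf->. Qed.

Lemma adj_transpK i : involutive (adj_transp i).
Proof. by move=> k; rewrite /adj_transp; repeat case: eqP; lia. Qed.

Lemma swapK i : involutive (swap i).
Proof. by move=> f; apply/funext => k; rewrite /swap adj_transpK. Qed.

Lemma swapC i j f : i.+1 < j -> swap i (swap j f) = swap j (swap i f).
Proof.
move=> lt_ij; apply/funext => k; rewrite /swap; congr f; rewrite /adj_transp.
by repeat case: eqP; lia.
Qed.

Lemma swap_braid i f :
  swap i (swap i.+1 (swap i f)) = swap i.+1 (swap i (swap i.+1 f)).
Proof.
apply/funext => k; rewrite /swap; congr f; rewrite /adj_transp.
by repeat case: eqP; lia.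
Qed.

Lemma swap_asc i f : (swap i f i < swap i f i.+1) = (f i.+1 < f i).
Proof. by rewrite /swap adj_transpL adj_transpR. Qed.

Lemma bubble_idem i f : bubble i (bubble i f) = bubble i f.
Proof.
rewrite {2 3}/bubble; case: ifP => lt_f; rewrite /bubble ?swap_asc ?lt_f //.
by case: ifP => //; lia.
Qed.

(** The max/min form removes the case split on the order of the two entries, so that the Hecke
    relations become identities of max and min. *)
Lemma bubbleE i f k : bubble i f k =
  if k == i then maxn (f i) (f i.+1)
  else if k == i.+1 then minn (f i) (f i.+1) else f k.
Proof.
rewrite /bubble; case: ifP => lt_f; rewrite /swap /adj_transp;
  by case: (k =P i) => [?|?]; [subst|case: (k =P i.+1) => [?|?]; [subst|]]; lia.
Qed.

Lemma bubbleC i j f : i.+1 < j -> bubble i (bubble j f) = bubble j (bubble i f).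
Proof.
move=> lt_ij; apply/funext => k; rewrite !bubbleE.
have -> : (i == j) = false by lia.
have -> : (i == j.+1) = false by lia.
have -> : (i.+1 == j) = false by lia.
have -> : (i.+1 == j.+1) = false by lia.
have -> : (j == i) = false by lia.
have -> : (j == i.+1) = false by lia.
have -> : (j.+1 == i) = false by lia.
have -> : (j.+1 == i.+1) = false by lia.
by repeat case: eqP => ?; lia.
Qed.

Lemma bubble_braid i f :
  bubble i (bubble i.+1 (bubble i f)) = bubble i.+1 (bubble i (bubble i.+1 f)).
Proof.
have e1 : (i == i.+1) = false by lia.
have e2 : (i == i.+2) = false by lia.
have e3 : (i.+1 == i) = false by lia.
have e4 : (i.+1 == i.+2) = false by lia.
have e5 : (i.+2 == i) = false by lia.
have e6 : (i.+2 == i.+1) = false by lia.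
have e7 : forall m, (m == m :> nat) = true by move=> m; rewrite eqxx.
apply/funext => k; rewrite !bubbleE !(e1, e2, e3, e4, e5, e6, e7).
case: (k =P i) => [?|_]; first by subst k; rewrite ?(e1, e2, e3, e4, e5, e6, e7); lia.
case: (k =P i.+1) => [?|_]; first by subst k; rewrite ?(e1, e2, e3, e4, e5, e6, e7); lia.
case: (k =P i.+2) => [?|_]; [subst k|]; rewrite ?(e1, e2, e3, e4, e5, e6, e7); lia.
Qed.

(** The symmetric group on the positions 0, ..., n. Total functions on [nat] avoid casts between
    ordinals. *)
Definition fixes_above (n : nat) (f : nat -> nat) : Prop :=
  bijective f /\ forall k, n < k -> f k = k.

Lemma fixes_above_id n : fixes_above n id.
Proof. by split=> //; exists id. Qed.

Lemma fixes_above_swap n i f : i < n -> fixes_above n f -> fixes_above n (swap i f).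
Proof.
move=> lt_in [bij_f fix_f]; split.
  by apply: (bij_comp bij_f); exists (adj_transp i); apply: adj_transpK.
move=> k lt_nk; rewrite /swap adj_transpD ?fix_f //; apply/eqP; lia.
Qed.

Lemma fixes_above_bubble n i f :
  i < n -> fixes_above n f -> fixes_above n (bubble i f).
Proof. by rewrite /bubble; case: ifP => // _; apply: fixes_above_swap. Qed.

Lemma fixes_above_leq n f k : fixes_above n f -> k <= n -> f k <= n.
Proof.
move=> [bij_f fix_f] le_kn; rewrite leqNgt; apply/negP => lt_nf.
by have /(bij_inj bij_f) := fix_f _ lt_nf; lia.
Qed.

Lemma fixes_above_surj n f k :
  fixes_above n f -> k <= n -> exists2 l, l <= n & f l = k.
Proof.
move=> [[g fK gK] fix_f] le_kn; exists (g k); rewrite ?gK //.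
by rewrite leqNgt; apply/negP => lt_n; have := fix_f _ lt_n; rewrite gK; lia.
Qed.

(** Strict growth gives [h k >= k] by induction upwards from [a] and [h k <= k] by induction
    downwards from [b]. *)
Lemma incr_self_id (a b : nat) (h : nat -> nat) :
  (forall k, a <= k < b -> h k < h k.+1) ->
  (forall k, a <= k <= b -> a <= h k <= b) ->
  forall k, a <= k <= b -> h k = k.
Proof.
move=> incr_h h_ab k k_ab.
have ge_h : forall d, a + d <= b -> a + d <= h (a + d).
  elim=> [|d IH] le_b; first by have := h_ab (a + 0); lia.
  have := incr_h (a + d); rewrite addnS; lia.
have le_h : forall d, a + d <= b -> h (b - d) <= b - d.
  elim=> [|d IH] le_b; first by have := h_ab (b - 0); lia.
  have := incr_h (b - d.+1); have -> : (b - d.+1).+1 = b - d by lia.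
  lia.
have := ge_h (k - a); have := le_h (b - k).
have -> : a + (k - a) = k by lia.
have -> : b - (b - k) = k by lia.
lia.
Qed.

(** A potential in place of the number of inversions: earlier positions count more, so exchanging an
    ascent raises it. It is the induction measure and bounds the length of reduced words. *)
Definition weight (n : nat) (f : nat -> nat) : nat := \sum_(k < n.+1) (n - k) * f k.

Lemma weight_swap n i f : i < n -> f i < f i.+1 -> weight n f < weight n (swap i f).
Proof.
move=> lt_in lt_f.
have lt_i : i < n.+1 by lia.
have lt_i1 : i.+1 < n.+1 by lia.
pose i0 := Ordinal lt_i; pose i1 := Ordinal lt_i1.
have neq10 : i1 != i0 by rewrite -val_eqE /=; lia.
rewrite /weight (bigD1 i0) //= [X in _ < X](bigD1 i0) //=.
rewrite (bigD1 i1) //= [X in _ < _ + X](bigD1 i1) //=.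
rewrite (eq_bigr (fun k : 'I_n.+1 => (n - k) * swap i f k)); last first.
  by move=> k /andP[k0 k1]; rewrite /swap adj_transpD.
rewrite /swap adj_transpL adj_transpR; set S := \sum_(_ < _ | _) _.
have -> : n - i = (n - i.+1).+1 by lia.
nia.
Qed.

Lemma weight_bound n f : fixes_above n f -> weight n f <= n.+1 * (n * n).
Proof.
move=> fix_f; rewrite /weight.
apply: (leq_trans (n := \sum_(k < n.+1) n * n)); last first.
  by rewrite sum_nat_const card_ord.
apply: leq_sum => k _; apply: leq_mul; first exact: leq_subr.
by apply: (fixes_above_leq fix_f); have := ltn_ord k; lia.
Qed.

Lemma no_descent_id n f :
  fixes_above n f -> (forall i, i < n -> f i < f i.+1) -> f = id.
Proof.
move=> fix_f asc_f; apply/funext => k.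
have [le_kn|lt_nk] := leqP k n; last exact: fix_f.2.
apply: (@incr_self_id 0 n) => // l le_ln.
exact: fixes_above_leq.
Qed.

(** * Reduced words and Matsumoto's theorem *)

Section Words.
Variable n : nat.
Implicit Types (f g : nat -> nat) (i j : 'I_n) (u v w : seq 'I_n).

Definition cact f u : nat -> nat := foldl (fun f (i : 'I_n) => swap i f) f u.
Definition hact f u : nat -> nat := foldl (fun f (i : 'I_n) => bubble i f) f u.

Lemma cact_cat f u v : cact f (u ++ v) = cact (cact f u) v.
Proof. exact: foldl_cat. Qed.

Lemma hact_cat f u v : hact f (u ++ v) = hact (hact f u) v.
Proof. exact: foldl_cat. Qed.

Lemma cact_rcons f u i : cact f (rcons u i) = swap i (cact f u).
Proof. by rewrite -cats1 cact_cat. Qed.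

Lemma hact_rcons f u i : hact f (rcons u i) = bubble i (hact f u).
Proof. by rewrite -cats1 hact_cat. Qed.

(** Inductive form of reducedness: the word leads from the identity to [f] and every letter
    exchanges an ascent. Along such a word [swap] and [bubble] agree. *)
Inductive red : (nat -> nat) -> seq 'I_n -> Prop :=
| red_nil : red id [::]
| red_rcons f u i : f i < f i.+1 -> red f u -> red (swap i f) (rcons u i).

Lemma red_fixes f u : red f u -> fixes_above n f.
Proof.
elim=> [|{}f {}u i _ _ IH]; first exact: fixes_above_id.
exact: fixes_above_swap.
Qed.

Lemma red_cact f u : red f u -> cact id u = f.
Proof. by elim=> [//|{}f {}u i _ _ IH]; rewrite cact_rcons IH. Qed.

Lemma red_hact f u : red f u -> hact id u = f.
Proof.
by elim=> [//|{}f {}u i lt_f _ IH]; rewrite hact_rcons IH /bubble lt_f.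
Qed.

Lemma red_size f u : red f u -> size u <= n.+1 * (n * n).
Proof.
move=> red_f; apply: leq_trans (weight_bound (red_fixes red_f)).
elim: red_f => [//|{}f {}u i lt_f _ IH]; rewrite size_rcons.
exact: leq_ltn_trans IH (weight_swap (ltn_ord i) lt_f).
Qed.

Lemma red_inv f u : red f u ->
  (f = id /\ u = [::]) \/
  exists v i, [/\ u = rcons v i, f i.+1 < f i & red (swap i f) v].
Proof.
case=> [|{}f {}u i lt_f red_f]; [by left | right; exists u, i].
by split; rewrite ?swapK // -swap_asc swapK.
Qed.

Lemma red_last f v i : red (swap i f) v -> f i.+1 < f i -> red f (rcons v i).
Proof. by move=> red_f lt_f; rewrite -[f](swapK i); apply: red_rcons; rewrite ?swap_asc. Qed.

(** Undoing a descent lowers the weight, and a sequence without descents is the identity. *)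
Lemma red_exists f : fixes_above n f -> exists u, red f u.
Proof.
have [m] := ubnP (weight n f); elim: m f => // m IH f lt_m fix_f.
have [[i desc_i]|no_desc] := pselect (exists i : 'I_n, f i.+1 < f i).
  have [|u red_u] := IH (swap i f) _ (fixes_above_swap (ltn_ord i) fix_f).
    rewrite -ltnS; apply: leq_ltn_trans lt_m; rewrite -{2}[f](swapK i).
    by apply: weight_swap => //; rewrite swap_asc.
  by exists (rcons u i); apply: red_last.
exists [::]; rewrite (no_descent_id fix_f); first exact: red_nil.
move=> i lt_in; rewrite ltn_neqAle leqNgt; apply/andP; split.
  by apply/eqP => /(bij_inj fix_f.1); lia.
by apply/negP => desc_i; apply: no_desc; exists (Ordinal lt_in).
Qed.

(** The quadratic relations are left out, so this equivalence is common to the Coxeter and the Hecke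
    presentations. *)
Inductive braid_rel : seq 'I_n -> seq 'I_n -> Prop :=
| braid_far i j : i.+1 < j -> braid_rel [:: i; j] [:: j; i]
| braid_near i j : j = i.+1 :> nat -> braid_rel [:: i; j; i] [:: j; i; j].

Notation braid := (congr_closure braid_rel).

Lemma braid_rcons u v i : braid u v -> braid (rcons u i) (rcons v i).
Proof. by move=> uv; rewrite -!cats1; apply: congr_cat => //; apply: congr_refl. Qed.

Lemma braid_size u v : braid u v -> size u = size v.
Proof.
elim=> {u v} [u v []|u|u v _|u v w _ -> _|u u' v v' _ IH _ IH'] //.
by rewrite !size_cat IH IH'.
Qed.

(* Matsumoto's theorem: two reduced words with distinct last letters i and j are
   compared through reduced words ending with the longest word in i and j. *)
Lemma red_braid f u v : red f u -> red f v -> braid u v.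
Proof.
have [m] := ubnP (weight n f); elim: m f u v => // m IH f u v lt_m red_u red_v.
have fix_f := red_fixes red_u.
have IHr i w1 w2 : f i.+1 < f i -> red (swap i f) w1 -> red (swap i f) w2 ->
    braid (rcons w1 i) (rcons w2 i).
  move=> desc_i r1 r2; apply: braid_rcons; apply: IH r1 r2.
  rewrite -ltnS; apply: leq_ltn_trans lt_m; rewrite -{2}[f](swapK i).
  by apply: weight_swap => //; rewrite swap_asc.
have key i j u1 v1 : i < j -> f i.+1 < f i -> f j.+1 < f j ->
    red (swap i f) u1 -> red (swap j f) v1 -> braid (rcons u1 i) (rcons v1 j).
  move=> lt_ij desc_i desc_j ru rv.
  (* By [IHr], [u1] and [v1] may be replaced by any other reduced words of the same sequences, so
     one well-chosen pair is enough. *)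
  suff [x [y [rx ry xy]]] : exists x y, [/\ red (swap i f) x, red (swap j f) y
      & braid (rcons x i) (rcons y j)].
    apply: congr_trans (IHr _ _ _ desc_i ru rx) _.
    exact: congr_trans xy (IHr _ _ _ desc_j ry rv).
  have [far|near] : i.+1 < j \/ j = i.+1 :> nat by lia.
    have [|w rw] := @red_exists (swap i (swap j f)).
      by do 2!apply: fixes_above_swap => //.
    exists (rcons w j), (rcons w i); split.
    - apply: red_last; first by rewrite -swapC.
      by rewrite /swap !adj_transpD //; apply/eqP; lia.
    - by apply: red_last => //; rewrite /swap !adj_transpD //; apply/eqP; lia.
    rewrite -!cats1 -!catA; apply: congr_cat; first exact: congr_refl.
    by apply: congr_sym; apply: congr_base; apply: braid_far.
  (* [w] spells [f] with the longest element in i and j stripped from its end; both w i j i and w j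
     i j are then reduced words of [f]. *)
  have [|w rw] := @red_exists (swap i (swap j (swap i f))).
    by do 3!apply: fixes_above_swap => //.
  rewrite near in desc_j rw.
  exists (rcons (rcons w i) j), (rcons (rcons w j) i); split.
  - apply: red_last; first apply: red_last; rewrite ?near //.
      rewrite /swap [adj_transp i.+1 i]adj_transpD ?adj_transpL ?adj_transpR //;
        try by apply/eqP; lia.
      by rewrite adj_transpD //; apply/eqP; lia.
    rewrite /swap adj_transpR adj_transpD //; apply/eqP; lia.
  - rewrite near; apply: red_last; first apply: red_last; rewrite ?near -?swap_braid //.
      rewrite /swap [adj_transp i i.+2]adj_transpD ?adj_transpR ?adj_transpL //;
        try by apply/eqP; lia.
      by rewrite adj_transpD //; apply/eqP; lia.
    rewrite /swap adj_transpL adj_transpD //; apply/eqP; lia.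
  rewrite -!cats1 -!catA; apply: congr_cat; first exact: congr_refl.
  by apply: congr_base; apply: braid_near.
case: (red_inv red_u) => [[f1 ->]|[u1 [i [-> desc_i ru]]]];
  case: (red_inv red_v) => [[f2 ->]|[v1 [j [-> desc_j rv]]]].
- exact: congr_refl.
- by move: desc_j; rewrite f1; lia.
- by move: desc_i; rewrite f2; lia.
case: (ltngtP i j) => [lt_ij|lt_ji|/val_inj eq_ij].
- exact: key.
- by apply: congr_sym; apply: key.
by rewrite -eq_ij in rv *; apply: IHr.
Qed.

End Words.

(** * Coxeter group and Hecke monoid of type A as sequences *)

Lemma congr_closure_sub (T : Type) (R R' : seq T -> seq T -> Prop) u v :
  (forall x y, R x y -> congr_closure R' x y) ->
  congr_closure R u v -> congr_closure R' u v.
Proof.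
move=> sub; elim=> {u v} [u v /sub //|u|u v _|u v w _ IH _ IH'|u u' v v' _ IH _ IH'].
- exact: congr_refl.
- exact: congr_sym.
- exact: congr_trans IH IH'.
- exact: congr_cat.
Qed.

Lemma congr_closure_foldl (T S : Type) (R : seq T -> seq T -> Prop) (act : S -> T -> S) u v :
  (forall x y, R x y -> forall s, foldl act s x = foldl act s y) ->
  congr_closure R u v -> forall s, foldl act s u = foldl act s v.
Proof.
move=> actR; elim=> {u v} [u v /actR //|//|u v _ IH s|u v w _ IH _ IH' s|u u' v v' _ IH _ IH' s].
- by rewrite IH.
- by rewrite IH.
- by rewrite !foldl_cat IH.
Qed.

Section TypeA.
Variable n : nat.
Implicit Types (f g : nat -> nat) (i j : 'I_n) (u v w : seq 'I_n).
Implicit Types (x y : hecke (A_ n)) (a b : coxeter (A_ n)).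

Lemma braid_congr (R : seq 'I_n -> seq 'I_n -> Prop) u v :
  (forall i j m, i != j -> A_ n i j = Some m ->
     R (alternating i j m) (alternating j i m)) ->
  congr_closure (@braid_rel n) u v -> congr_closure R u v.
Proof.
move=> braidR; apply: congr_closure_sub => {u v} _ _ [i j lt_ij|i j eq_ij].
  apply: congr_base; apply: (braidR i j 2); first by rewrite -val_eqE /=; lia.
  by rewrite /= /A_entry -val_eqE /= !ifF //; lia.
apply: congr_base; apply: (braidR i j 3); first by rewrite -val_eqE /=; lia.
by rewrite /= /A_entry -val_eqE /= ifF ?ifT //; lia.
Qed.

Lemma A_braid_act (op : nat -> (nat -> nat) -> (nat -> nat)) i j m f :
  (forall i j f, i.+1 < j -> op i (op j f) = op j (op i f)) ->
  (forall i f, op i (op i.+1 (op i f)) = op i.+1 (op i (op i.+1 f))) ->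
  i != j -> A_ n i j = Some m ->
  let act f (i : 'I_n) := op i f in
  foldl act f (alternating i j m) = foldl act f (alternating j i m).
Proof.
move=> opC opB neq_ij; rewrite /= /A_entry (negPf neq_ij) => -[<-].
have neq_nat : i != j :> nat by [].
case: ifP => [/orP[/eqP|/eqP] eq_ij|no_edge] /=.
- by rewrite -!eq_ij opB.
- by rewrite -!eq_ij opB.
have [lt_ij|lt_ji] : i.+1 < j \/ j.+1 < i by lia.
- by rewrite (opC i j).
- by rewrite (opC j i).
Qed.

Lemma cact_congr f u v :
  congr_closure (coxeter_rel (A_ n)) u v -> cact f u = cact f v.
Proof.
move=> uv; apply: congr_closure_foldl uv f => _ _ [i|i j m neq_ij Mij] f /=.
  by rewrite swapK.
exact: A_braid_act swapC swap_braid neq_ij Mij.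
Qed.

Lemma hact_congr f u v :
  congr_closure (hecke_rel (A_ n)) u v -> hact f u = hact f v.
Proof.
move=> uv; apply: congr_closure_foldl uv f => _ _ [i|i j m neq_ij Mij] f /=.
  by rewrite bubble_idem.
exact: A_braid_act bubbleC bubble_braid neq_ij Mij.
Qed.

Definition cox_perm a : nat -> nat := cact id (word_repr a).
Definition hecke_perm x : nat -> nat := hact id (word_repr x).

Lemma cox_permE u : cox_perm (cox_word (A_ n) u) = cact id u.
Proof. exact/cact_congr/word_repr_congr. Qed.

Lemma hecke_permE u : hecke_perm (hecke_word (A_ n) u) = hact id u.
Proof. exact/hact_congr/word_repr_congr. Qed.

Lemma cox_wordK a : cox_word (A_ n) (word_repr a) = a.
Proof. exact: word_reprK. Qed.

Lemma hecke_wordK x : hecke_word (A_ n) (word_repr x) = x.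
Proof. exact: word_reprK. Qed.

Lemma cact_fixes f u : fixes_above n f -> fixes_above n (cact f u).
Proof. by elim: u f => //= i u IH f fix_f; apply/IH/fixes_above_swap. Qed.

Lemma hact_fixes f u : fixes_above n f -> fixes_above n (hact f u).
Proof. by elim: u f => //= i u IH f fix_f; apply/IH/fixes_above_bubble. Qed.

Lemma cact_comp f u k : cact f u k = f (cact id u k).
Proof. by elim/last_ind: u k => //= u i IH k; rewrite !cact_rcons /swap IH. Qed.

Lemma asc_or_desc f i : fixes_above n f -> f i < f i.+1 \/ f i.+1 < f i.
Proof.
move=> [bij_f _]; case: (ltngtP (f i) (f i.+1)) => [||/(bij_inj bij_f)]; first by left.
  by right.
by lia.
Qed.

(** Induction on the last letter: at an ascent it extends a reduced word; at a descent the reduced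
    word may be chosen to end with the same letter, and the two cancel. Faithfulness of the action
    follows. *)
Lemma cact_red u v : red (cact id u) v -> congr_closure (coxeter_rel (A_ n)) u v.
Proof.
have bc := braid_congr (@coxeter_braid _ (A_ n)).
elim/last_ind: u v => [|u i IH] v.
  by move=> /(red_braid (red_nil n))/bc.
rewrite cact_rcons; have fix_f := cact_fixes u (fixes_above_id n).
have [w rw] := red_exists fix_f; rewrite -cats1 => rv.
apply: congr_trans (congr_cat (IH _ rw) (congr_refl _ [:: i])) _.
have [asc_i|desc_i] := asc_or_desc i fix_f.
  by apply/bc; rewrite cats1; apply: red_braid rv; apply: red_rcons.
have /bc rwv := red_braid rw (red_last rv desc_i).
apply: congr_trans (congr_cat rwv (congr_refl _ [:: i])) _.
rewrite -cats1 -catA -[X in congr_closure _ _ X]cats0.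
by apply: congr_cat; [apply: congr_refl | apply: congr_base; left].
Qed.

(** As for [cact_red], except that at a descent the repeated letter is absorbed instead of
    cancelled. *)
Lemma hact_red u v : red (hact id u) v -> congr_closure (hecke_rel (A_ n)) u v.
Proof.
have bc := braid_congr (@hecke_braid _ (A_ n)).
elim/last_ind: u v => [|u i IH] v.
  by move=> /(red_braid (red_nil n))/bc.
rewrite hact_rcons; have fix_f := hact_fixes u (fixes_above_id n).
have [w rw] := red_exists fix_f; rewrite -cats1 => rv.
apply: congr_trans (congr_cat (IH _ rw) (congr_refl _ [:: i])) _.
have [asc_i|desc_i] := asc_or_desc i fix_f.
  rewrite /bubble asc_i in rv.
  by apply/bc; rewrite cats1; apply: red_braid rv; apply: red_rcons.
have [x rx] := red_exists (fixes_above_swap (ltn_ord i) fix_f).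
have rxi := red_last rx desc_i.
have /bc rwx := red_braid rw rxi.
apply: congr_trans (congr_cat rwx (congr_refl _ [:: i])) _.
rewrite -cats1 -catA; apply: (@congr_trans _ _ (x ++ [:: i])).
  by apply: congr_cat; [apply: congr_refl | apply: congr_base; left].
apply/bc; rewrite cats1; apply: red_braid rxi _.
by move: rv; rewrite /bubble ltnNge (ltnW desc_i).
Qed.

Lemma cox_perm_fixes a : fixes_above n (cox_perm a).
Proof. exact/cact_fixes/fixes_above_id. Qed.

Lemma hecke_perm_fixes x : fixes_above n (hecke_perm x).
Proof. exact/hact_fixes/fixes_above_id. Qed.

Lemma cox_perm_inj : injective cox_perm.
Proof.
move=> a b eq_ab; have [v rv] := red_exists (cox_perm_fixes a).
rewrite -(cox_wordK a) -(cox_wordK b); apply/word_classP.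
apply: congr_trans (cact_red rv) _.
by apply: congr_sym; apply: cact_red; rewrite -/(cox_perm b) -eq_ab.
Qed.

Lemma hecke_perm_inj : injective hecke_perm.
Proof.
move=> x y eq_xy; have [v rv] := red_exists (hecke_perm_fixes x).
rewrite -(hecke_wordK x) -(hecke_wordK y); apply/word_classP.
apply: congr_trans (hact_red rv) _.
by apply: congr_sym; apply: hact_red; rewrite -/(hecke_perm y) -eq_xy.
Qed.

Lemma cox_permM a b : cox_perm (a * b)%g = cox_perm a \o cox_perm b.
Proof.
rewrite -(cox_wordK a) -(cox_wordK b) -word_class_cat !cox_permE cact_cat.
by apply/funext => k; rewrite cact_comp.
Qed.

Lemma cox_perm1 : cox_perm 1%g = id.
Proof. exact: (cox_permE [::]). Qed.

Lemma cox_perm_gen i : cox_perm (cox_gen (A_ n) i) = swap i id.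
Proof. exact: (cox_permE [:: i]). Qed.

Lemma hecke_permM x v : hecke_perm (x * hecke_word (A_ n) v)%g = hact (hecke_perm x) v.
Proof. by rewrite -{1}(hecke_wordK x) -word_class_cat hecke_permE hact_cat. Qed.

Lemma hecke_perm1 : hecke_perm 1%g = id.
Proof. exact: (hecke_permE [::]). Qed.

Lemma red_hecke_word x v : red (hecke_perm x) v -> hecke_word (A_ n) v = x.
Proof. by move=> rv; apply: hecke_perm_inj; rewrite hecke_permE (red_hact rv). Qed.

(** Each letter lengthens or shortens the reduced word by one, so a word as short as its reduced
    form has never met a descent. *)
Lemma red_leq_size u v :
  red (cact id u) v -> size v <= size u /\ (size v = size u -> red (cact id u) u).
Proof.
elim/last_ind: u v => [|u i IH] v.
  by move=> /(red_braid (red_nil n))/braid_size <-; split=> // _; apply: red_nil.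
rewrite cact_rcons size_rcons; have fix_f := cact_fixes u (fixes_above_id n).
have [w rw] := red_exists fix_f; have [le_wu eq_wu] := IH _ rw.
have [asc_i|desc_i] := asc_or_desc i fix_f => rv.
  have := braid_size (red_braid rv (red_rcons asc_i rw)).
  rewrite size_rcons => size_v; split; first by lia.
  by move=> size_vu; apply: red_rcons => //; apply: eq_wu; lia.
have := braid_size (red_braid rw (red_last rv desc_i)).
by rewrite size_rcons; lia.
Qed.

Lemma reduced_red u : reduced (A_ n) u <-> red (cact id u) u.
Proof.
split=> [min_u|ru v /(congr1 cox_perm)].
  have [v rv] := red_exists (cact_fixes u (fixes_above_id n)).
  have [le_vu] := red_leq_size rv; apply; apply/eqP; rewrite eqn_leq le_vu /=.
  by apply: min_u; apply: cox_perm_inj; rewrite !cox_permE (red_cact rv).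
rewrite !cox_permE => eq_vu; rewrite -eq_vu in ru.
by have [] := red_leq_size ru.
Qed.

Lemma reduced_wordP a :
  cox_word (A_ n) (reduced_word a) = a /\ red (cox_perm a) (reduced_word a).
Proof.
rewrite /reduced_word; case: cid => u [/= uE /reduced_red ru].
by split=> //; rewrite -uE cox_permE.
Qed.

(** On a reduced word sorting and exchanging coincide, so the identification of the two underlying
    sets does not change the sequence. *)
Lemma hecke_perm_to_hecke a : hecke_perm (to_hecke a) = cox_perm a.
Proof. by have [_ ru] := reduced_wordP a; rewrite hecke_permE (red_hact ru). Qed.

Lemma cox_length_red a v : red (cox_perm a) v -> cox_length a = size v.
Proof.
by have [_ ru] := reduced_wordP a; move=> /(red_braid ru)/braid_size.
Qed.

(** Reduced words have bounded length. This settles every [finite_type] condition in type A. *)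
Lemma finite_coxeter_A (S : set (coxeter (A_ n))) : finite_set S.
Proof.
pose N := n.+1 * (n * n).
apply: (@sub_finite_set _ _
  ((fun u : N.-bseq 'I_n => cox_word (A_ n) u) @` [set: N.-bseq 'I_n]%classic)).
  move=> a _; have [au ru] := reduced_wordP a.
  by exists (Bseq (red_size ru)).
exact/finite_image/finite_finset.
Qed.

End TypeA.

(** * Homomorphisms and longest elements *)

Lemma cox_wordM (I : finType) (M : coxeter_matrix I) (u v : seq I) :
  cox_word M (u ++ v) = (cox_word M u * cox_word M v)%g.
Proof. exact: word_class_cat. Qed.

Lemma hecke_wordM (I : finType) (M : coxeter_matrix I) (u v : seq I) :
  hecke_word M (u ++ v) = (hecke_word M u * hecke_word M v)%g.
Proof. exact: word_class_cat. Qed.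

Lemma hecke_gen_idem (I : finType) (M : coxeter_matrix I) i :
  (hecke_gen M i * hecke_gen M i)%g = hecke_gen M i.
Proof. by rewrite -hecke_wordM; apply/word_classP/congr_base; left. Qed.

Lemma hecke_rev (I : finType) (M : coxeter_matrix I) (u v : seq I) :
  congr_closure (hecke_rel M) u v -> congr_closure (hecke_rel M) (rev u) (rev v).
Proof.
elim=> {u v} [u v|u|u v _ IH|v u w _ IH1 _ IH2|u u' v v' _ IH1 _ IH2].
- case=> [i|i j m neq_ij Mij]; first by apply: congr_base; left.
  rewrite !rev_alternating; case: ifP => _.
    by apply: congr_base; right.
  by apply: congr_sym; apply: congr_base; right.
- exact: congr_refl.
- exact: congr_sym.
- exact: congr_trans IH1 IH2.
- by rewrite !rev_cat; apply: congr_cat.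
Qed.

Lemma mem_alternating (I : finType) (M : coxeter_matrix I) (i j k : I) m :
  i != j -> M i j = Some m -> (k \in alternating i j m) = (k \in [:: i; j]).
Proof.
move=> neq_ij Mij; have lt1m := cox_offdiag neq_ij Mij.
rewrite !inE; apply/mapP/idP => [[l _ ->]|/orP[]/eqP->].
- by case: odd; rewrite eqxx ?orbT.
- by exists 0; rewrite // mem_iota; lia.
- by exists 1; rewrite // mem_iota; lia.
Qed.

(** Both sides of each Hecke relation have the same letters, in contrast with the Coxeter relation
    [[:: i; i]] to [[::]]. Supports can thus be read off any word. *)
Lemma hecke_letters (I : finType) (M : coxeter_matrix I) (u v : seq I) :
  hecke_word M u = hecke_word M v -> u =i v.
Proof.
move=> /word_classP; elim=> {u v} [u v uv|//|u v _ IH|v u w _ IH1 _ IH2|u u' v v' _ IH1 _ IH2] k.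
- case: uv => [i|i j m neq_ij Mij]; first by rewrite !inE orbb.
  rewrite !(mem_alternating (M := M)) // 1?eq_sym 1?cox_sym // !inE orbC //.
- by rewrite IH.
- by rewrite IH1.
- by rewrite !mem_cat IH1 IH2.
Qed.

Section HeckeHom.
Variables (I' I : finType) (M' : coxeter_matrix I') (M : coxeter_matrix I).

Lemma hecke_hom_word (phi : hecke_hom M' M) u :
  phi (hecke_word M' u) = (\prod_(i <- u) phi (hecke_gen M' i))%g.
Proof.
elim: u => [|i u IH]; first by rewrite big_nil; apply: gmulf1.
by rewrite big_cons -IH -gmulfM -hecke_wordM.
Qed.

(** The universal property of the Hecke presentation. *)
Lemma hecke_hom_lift (f : I' -> hecke M) :
  (forall i, (f i * f i)%g = f i) ->
  (forall i j m, i != j -> M' i j = Some m ->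
     (\prod_(k <- alternating i j m) f k)%g = (\prod_(k <- alternating j i m) f k)%g) ->
  exists phi : hecke_hom M' M, forall i, phi (hecke_gen M' i) = f i.
Proof.
move=> f_idem f_braid.
pose F (x : hecke M') : hecke M := (\prod_(k <- word_repr x) f k)%g.
have FE u : F (hecke_word M' u) = (\prod_(k <- u) f k)%g.
  have := @word_repr_congr _ (hecke_rel M') u.
  rewrite /F -/(hecke_word M' u); move: (word_repr _) => v.
  elim=> {u v} [u v|//|u v _ //|v u w _ -> //|u u' v v' _ IH1 _ IH2].
    by case=> [i|i j m]; [rewrite !big_cons !big_nil !mulg1 f_idem | apply: f_braid].
  by rewrite !big_cat /= IH1 IH2.
have F1 : F 1%g = 1%g by rewrite (FE [::]) big_nil.
have FM : {morph F : x y / (x * y)%g >-> (x * y)%g}.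
  move=> x y; rewrite -[x]word_reprK -[y]word_reprK.
  by rewrite -!/(hecke_word M' _) -hecke_wordM !FE big_cat.
pose phi : hecke_hom M' M := HB.pack F (isUMagmaMorphism.Build _ _ F (conj F1 FM)).
by exists phi => i; rewrite /phi /= FE big_seq1.
Qed.
End HeckeHom.

(** * Longest elements as absorbing elements and as idempotents *)

Section Longest.
Variable n : nat.
Implicit Types (f g : nat -> nat) (i j : 'I_n) (u v w : seq 'I_n) (J K : {set 'I_n}).
Implicit Types (x y : hecke (A_ n)) (a b : coxeter (A_ n)).

(** Membership in the Young subgroup of [J]: no value crosses the cut between positions k and k+1 at
    a node k outside [J]. *)
Definition preserves J f : Prop :=
  forall k : 'I_n, k \notin J -> forall l, (f l <= k) = (l <= k).

Lemma parabolic_preserves J a :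
  parabolic_subgroup J a -> preserves J (cox_perm a).
Proof.
move=> Ja; have := Ja (fun a => `[< preserves J (cox_perm a) >]).
rewrite unfold_in => /(_ _ _)/asboolP; apply.
  split=> [|b c]; rewrite !unfold_in.
    by apply/asboolP => k _ l; rewrite cox_perm1.
  move=> /asboolP pb /asboolP pc; apply/asboolP => k k_J l.
  (* Closure is tested on [b * c^-1], so the position [l] is written as the image under [c] of its
     preimage. *)
  have [[g gK Kg] _] := cox_perm_fixes c.
  rewrite -[l]Kg; move: (g l) => {}l.
  have <- : cox_perm b l = cox_perm (b * c^-1)%g (cox_perm c l).
    by rewrite -{1}[b](mulgVK c) cox_permM.
  by rewrite pb // pc.
move=> j j_J; rewrite unfold_in; apply/asboolP => k k_J l.
rewrite cox_perm_gen /swap /adj_transp.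
have neq_k : k != j :> nat by apply: contraNneq k_J => /val_inj ->.
by do 2?case: eqP; lia.
Qed.

(** At a node outside [J] the cut forces an ascent, whereas the last letter has just created a
    descent; so that letter is in [J], and removing it keeps the cuts. *)
Lemma red_preserves J f u : red f u -> preserves J f -> all [in J] u.
Proof.
elim=> [//|{}f {}u i asc_i red_u IH] pJ; rewrite all_rcons.
have i_J : i \in J.
  apply/negPn/negP => /pJ pi; have := pi i; have := pi i.+1.
  by rewrite /swap adj_transpL adj_transpR; lia.
rewrite /= i_J IH // => k k_J l; rewrite -{1}[l](adj_transpK i).
rewrite -/(swap i f _) pJ // /adj_transp.
have neq_k : k != i :> nat by apply: contraNneq k_J => /val_inj ->.
by do 2?case: eqP; lia.
Qed.

(** [longest] is chosen by [xget] with default value 1, so a maximiser has to be exhibited; one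
    exists because lengths are bounded. *)
Lemma longest_spec J : parabolic_subgroup J (longest (A_ n) J) /\
  forall b, parabolic_subgroup J b -> cox_length b <= cox_length (longest (A_ n) J).
Proof.
pose maximal a := parabolic_subgroup J a /\
  forall b, parabolic_subgroup J b -> cox_length b <= cox_length a.
suff : exists a, maximal a by exact: (@xgetPex _ 1%g maximal).
pose P m := `[< exists2 a : coxeter (A_ n), parabolic_subgroup J a & cox_length a = m >].
have exP : exists m, P m.
  exists (cox_length (1%g : coxeter (A_ n))); apply/asboolP; exists 1%g => //.
  by move=> S [].
have boundP m : P m -> m <= n.+1 * (n * n).
  by case/asboolP=> a _ <-; have [_ /red_size] := reduced_wordP a.
case: (ex_maxnP exP boundP) => m /asboolP[a Ja <-] max_m.
by exists a; split=> // b Jb; apply: max_m; apply/asboolP; exists b.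
Qed.

Lemma longest_preserves J : preserves J (cox_perm (longest (A_ n) J)).
Proof. by apply: parabolic_preserves; have [] := longest_spec J. Qed.

(** At an ascent, multiplying by the generator would give a longer element of the parabolic
    subgroup. *)
Lemma longest_desc J j : j \in J ->
  cox_perm (longest (A_ n) J) j.+1 < cox_perm (longest (A_ n) J) j.
Proof.
move=> j_J; have [Ja max_a] := longest_spec J; move: (longest _ _) Ja max_a => a Ja max_a.
have [asc_j|//] := asc_or_desc j (cox_perm_fixes a).
have [_ ru] := reduced_wordP a.
have : parabolic_subgroup J (a * cox_gen (A_ n) j)%g.
  by move=> S cS gS; apply: (group_closedM cS); [apply: Ja | apply: gS].
move/max_a; rewrite (cox_length_red ru) (@cox_length_red _ _ (rcons (reduced_word a) j)).
  by rewrite size_rcons ltnn.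
by rewrite cox_permM cox_perm_gen; apply: red_rcons asc_j ru.
Qed.

Definition longest_hecke J : hecke (A_ n) := to_hecke (longest (A_ n) J).

Definition absorbs J x : Prop := forall j, j \in J -> (x * hecke_gen (A_ n) j)%g = x.

Lemma absorbsP J x :
  absorbs J x <-> forall j, j \in J -> hecke_perm x j.+1 < hecke_perm x j.
Proof.
have fix_x := hecke_perm_fixes x.
split=> [abs_x|desc_x] j j_J; last first.
  by apply: hecke_perm_inj; rewrite hecke_permM /= /bubble ltnNge (ltnW (desc_x _ j_J)).
have [asc_j|//] := asc_or_desc j fix_x.
have /(congr1 (@hecke_perm n)) := abs_x _ j_J; rewrite hecke_permM /= /bubble asc_j.
by move=> swap_j; have := congr1 (fun f => f (j : nat)) swap_j; rewrite /swap adj_transpL; lia.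
Qed.

Lemma longest_hecke_absorbs J : absorbs J (longest_hecke J).
Proof.
by apply/absorbsP => j j_J; rewrite hecke_perm_to_hecke longest_desc.
Qed.

Lemma longest_hecke_word J :
  exists2 u, all [in J] u & hecke_word (A_ n) u = longest_hecke J.
Proof.
have [_ ru] := reduced_wordP (longest (A_ n) J).
by exists (reduced_word (longest (A_ n) J)) => //; apply: red_preserves ru (@longest_preserves J).
Qed.

Lemma absorbs_word J x u : absorbs J x -> all [in J] u ->
  (x * hecke_word (A_ n) u)%g = x.
Proof.
move=> abs_x; elim: u => [|i u IH] /=; first by rewrite mulg1.
by case/andP=> i_J u_J; rewrite -cat1s hecke_wordM mulgA abs_x // IH.
Qed.

(* Reversing words turns right absorption into left absorption, and a left
   absorbing element of the monoid generated by J equals any right absorbing one. *)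
Lemma absorbs_rev J u v : all [in J] u -> all [in J] v ->
  absorbs J (hecke_word (A_ n) u) -> absorbs J (hecke_word (A_ n) v) ->
  hecke_word (A_ n) u = hecke_word (A_ n) (rev v).
Proof.
move=> u_J v_J abs_u abs_v.
have := absorbs_word abs_u (u := rev v); rewrite all_rev => /(_ v_J) <-.
have := absorbs_word abs_v (u := rev u); rewrite all_rev => /(_ u_J).
rewrite -!hecke_wordM => /word_classP/hecke_rev; rewrite rev_cat revK => uv.
exact/word_classP.
Qed.

(** Both elements equal the class of [rev v], for a word [v] of the longest element. This is how
    longest elements are recognised below. *)
Lemma absorbs_uniq J u : all [in J] u -> absorbs J (hecke_word (A_ n) u) ->
  hecke_word (A_ n) u = longest_hecke J.
Proof.
move=> u_J abs_u; have [v v_J vE] := longest_hecke_word J.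
have abs_v := @longest_hecke_absorbs J; rewrite -vE in abs_v *.
by rewrite (absorbs_rev u_J v_J abs_u abs_v) -(absorbs_rev v_J v_J abs_v abs_v).
Qed.

(** The reversal of a reduced word [u] of the longest element is reduced and, by [absorbs_rev], has
    the same sequence; so it spells both the inverse and the element itself. *)
Lemma longest_sqr J : (longest (A_ n) J * longest (A_ n) J = 1)%g.
Proof.
have abs_E := @longest_hecke_absorbs J; rewrite /longest_hecke /to_hecke in abs_E.
have [aE ru] := reduced_wordP (longest (A_ n) J).
have u_J := red_preserves ru (@longest_preserves J).
move: (longest _ _) (reduced_word _) aE ru u_J abs_E => a u aE ru u_J abs_u.
have red_rev : red (cact id (rev u)) (rev u).
  apply/reduced_red => v /word_classP/coxeter_rev; rewrite revK => /word_classP vu.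
  rewrite size_rev -(size_rev v); apply: (proj2 (reduced_red u) _ _ vu).
  by rewrite -cox_permE aE.
suff -> : (a * a = cox_word (A_ n) u * cox_word (A_ n) (rev u))%g.
  by rewrite -cox_wordM cox_word_revr.
congr (_ * _)%g; first by rewrite aE.
apply: cox_perm_inj; rewrite cox_permE -(red_hact red_rev) -hecke_permE.
rewrite -(absorbs_rev u_J u_J abs_u abs_u) hecke_permE.
by rewrite (red_hact ru).
Qed.

Lemma hecke_supp_word u : hecke_supp (hecke_word (A_ n) u) = [set i in u]%SET.
Proof.
apply/setP => i; rewrite !inE; apply/asboolP/idP => [[v [_ /hecke_letters <- //]]|i_u].
have [v rv] := red_exists (hecke_perm_fixes (hecke_word (A_ n) u)).
exists v; split; first by apply/reduced_red; rewrite (red_cact rv).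
  exact: red_hecke_word.
by rewrite (hecke_letters (red_hecke_word rv)).
Qed.

(** A generator from [J] is absorbed, hence occurs among the letters by [hecke_letters]. *)
Lemma hecke_supp_longest J : hecke_supp (longest_hecke J) = J.
Proof.
have [u u_J uE] := longest_hecke_word J; rewrite -uE hecke_supp_word.
apply/setP => j; rewrite inE; apply/idP/idP => [|j_J]; first exact/allP.
have /longest_hecke_absorbs := j_J; rewrite -uE -hecke_wordM => /hecke_letters <-.
by rewrite mem_cat mem_seq1 eqxx orbT.
Qed.

Lemma weight_hact f u : fixes_above n f -> weight n f <= weight n (hact f u).
Proof.
elim: u f => //= i u IH f fix_f.
apply: leq_trans (IH _ (fixes_above_bubble (ltn_ord i) fix_f)).
by rewrite /bubble; case: ifP => // asc_i; apply/ltnW/weight_swap.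
Qed.

(** Sorting never lowers the weight and every actual exchange raises it, so a word that returns to
    [f] has moved nothing on the way. *)
Lemma hact_stable f u : fixes_above n f -> hact f u = f ->
  forall i, i \in u -> bubble i f = f.
Proof.
elim: u f => //= j u IH f fix_f fu.
have bj : bubble j f = f.
  rewrite /bubble; case: ifP => // asc_j.
  have := weight_hact u (fixes_above_bubble (ltn_ord j) fix_f).
  by rewrite fu /bubble asc_j; have := weight_swap (ltn_ord j) asc_j; lia.
rewrite bj in fu => i; rewrite inE => /orP[/eqP -> //|]; exact: IH.
Qed.

(** Idempotence says that a word of [x] fixes the sequence of [x]; by [hact_stable] each of its
    letters is absorbed. *)
Lemma hecke_idem_longest x : (x * x = x)%g -> x = longest_hecke (hecke_supp x).
Proof.
move=> xx; have := hecke_wordK x; move: (word_repr x) => u uE.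
rewrite -uE hecke_supp_word; apply: absorbs_uniq; first by apply/allP => i; rewrite inE.
move=> i; rewrite inE => i_u; apply: hecke_perm_inj; rewrite hecke_permM /=.
apply: hact_stable i_u; first exact: hecke_perm_fixes.
by rewrite -hecke_permM uE xx.
Qed.

Lemma longest_hecke_sub J K : J \subset K ->
  (longest_hecke K * longest_hecke J)%g = longest_hecke K.
Proof.
move=> /fintype.subsetP sJK; have [u u_J <-] := longest_hecke_word J.
apply: absorbs_word; first exact: longest_hecke_absorbs.
by apply: sub_all u_J.
Qed.

End Longest.

(** * Sorting intervals *)

Section Sorting.
Variable n : nat.
Implicit Types (f g : nat -> nat) (i j : 'I_n) (u v : seq 'I_n) (x y : hecke (A_ n)).

Local Notation E a b := (longest_hecke (A_interval n a b)).

(** The nodes c+1, ..., b are numbered from 1 and the positions from 0: this interval sorts exactly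
    the positions c, ..., b. *)
Lemma sort_out c b x k : k < c \/ b < k ->
  hecke_perm (x * E c.+1 b)%g k = hecke_perm x k.
Proof.
move=> out_k; have [u u_J <-] := longest_hecke_word (A_interval n c.+1 b).
rewrite hecke_permM; move: (hecke_perm x) => f.
elim: u f u_J => //= i u IH f /andP[]; rewrite inE => i_J /IH ->.
by rewrite bubbleE !ifF //; apply/eqP; lia.
Qed.

Lemma sort_desc c b x k : b <= n -> c <= k < b ->
  hecke_perm (x * E c.+1 b)%g k.+1 < hecke_perm (x * E c.+1 b)%g k.
Proof.
move=> le_bn k_cb; have lt_kn : k < n by lia.
have abs_y : absorbs (A_interval n c.+1 b) (x * E c.+1 b)%g.
  by move=> j j_J; rewrite -mulgA longest_hecke_absorbs.
by apply: (proj1 (absorbsP _ _) abs_y (Ordinal lt_kn)); rewrite inE /=; lia.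
Qed.

(* A block of positions sorted in decreasing order is determined by the set of its
   values, that is, by the values outside the block. *)
Lemma sort_in c b x g : b <= n ->
  (forall k, c <= k < b -> g k.+1 < g k) ->
  (forall k, c <= k <= b -> g k <= n) ->
  (forall k l, c <= k <= b -> l < c \/ b < l <= n -> hecke_perm x l <> g k) ->
  forall k, c <= k <= b -> hecke_perm (x * E c.+1 b)%g k = g k.
Proof.
move=> le_bn desc_g le_g neq_g.
have desc_h k : c <= k < b -> _ := @sort_desc c b x k le_bn.
have out_h k := @sort_out c b x k.
have fix_h := hecke_perm_fixes (x * E c.+1 b)%g.
move: (hecke_perm (x * _)%g) desc_h out_h fix_h => h desc_h out_h fix_h.
have [[t hK tK] _] := fix_h.
have mono_h d k : c <= k -> k + d <= b -> h (k + d) <= h k.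
  elim: d => [|d IH] le_ck le_b; first by rewrite addn0.
  by rewrite addnS; have := desc_h (k + d); have := IH le_ck; lia.
have tg_cb k : c <= k <= b -> c <= t (g k) <= b.
  move=> k_cb; have [out|] : (t (g k) < c \/ b < t (g k)) \/ c <= t (g k) <= b by lia.
    have := out_h _ out; rewrite tK => eq_g.
    case: (neq_g k (t (g k))) => //; have := le_g _ k_cb.
    have : t (g k) <= n; last by lia.
    have [l le_ln] := fixes_above_surj fix_h (le_g _ k_cb).
    by move=> <-; rewrite hK.
  by [].
suff tgK k : c <= k <= b -> t (g k) = k.
  by move=> k k_cb; rewrite -{1}[k](tgK _ k_cb) tK.
(* [g] and [h] both decrease on the block, so the inverse [t] of [h] composed with [g] is an
   increasing map of the block to itself. *)
apply: (@incr_self_id c b (t \o g)) => //= {}k k_cb.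
rewrite ltnNge; apply/negP => le_t.
have := mono_h (t (g k) - t (g k.+1)) (t (g k.+1)).
rewrite subnKC // !tK; have := desc_g k k_cb.
by have := tg_cb k; have := tg_cb k.+1; lia.
Qed.

Lemma A_intervalT : A_interval n 1 n = [set: 'I_n]%SET.
Proof. by apply/setP => i; rewrite !inE; have := ltn_ord i; lia. Qed.

Lemma hecke_permT k : k <= n -> hecke_perm (longest_hecke [set: 'I_n]%SET) k = n - k.
Proof.
move=> le_kn; rewrite -A_intervalT -[longest_hecke _]mul1g.
by apply: (@sort_in 0 n 1%g (fun k => n - k)) => // *; lia.
Qed.

Lemma hecke_perm_eq x y :
  (forall k, k <= n -> hecke_perm x k = hecke_perm y k) -> x = y.
Proof.
move=> eq_xy; apply/hecke_perm_inj/funext => k; have [/eq_xy //|lt_nk] := leqP k n.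
by rewrite !(proj2 (hecke_perm_fixes _)).
Qed.

Variables A B C : nat.
Hypotheses (A_gt0 : 0 < A) (B_gt0 : 0 < B) (C_gt0 : 0 < C) (sumABC : A + B + C = n.+1).

Let E1 := E 1 (A + C - 1).
Let E2 := E C.+1 n.

Lemma hecke_perm_J1 k : k <= n ->
  hecke_perm E1 k = if k < A + C then A + C - 1 - k else k.
Proof.
move=> le_kn; rewrite -[E1]mul1g; have [lt_k|ge_k] := ltnP k (A + C).
  by apply: (@sort_in 0 _ 1%g (fun k => A + C - 1 - k)) => [|l|l|l m|];
    rewrite ?hecke_perm1; lia.
by rewrite sort_out ?hecke_perm1 //; lia.
Qed.

Lemma hecke_perm_J2 k : k <= n ->
  hecke_perm E2 k = if k < C then k else n + C - k.
Proof.
move=> le_kn; rewrite -[E2]mul1g; have [lt_k|ge_k] := ltnP k C.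
  by rewrite sort_out ?hecke_perm1 //; lia.
by apply: (@sort_in C n 1%g (fun k => n + C - k)) => [|l|l|l m|];
  rewrite ?hecke_perm1; lia.
Qed.

(** Three decreasing runs: C positions with A+C-1, ..., A kept from [E1], then B positions with n,
    ..., A+C, then A positions with A-1, ..., 0. *)
Lemma hecke_perm_J12 k : k <= n -> hecke_perm (E1 * E2)%g k =
  if k < C then A + C - 1 - k else if k < B + C then n + C - k else n - k.
Proof.
move=> le_kn; have [lt_k|ge_k] := ltnP k C.
  by rewrite sort_out; [rewrite hecke_perm_J1 // ifT //; lia | lia].
apply: (@sort_in C n E1 (fun k => if k < B + C then n + C - k else n - k)) => //.
- by move=> l; repeat case: ifP; lia.
- by move=> l; repeat case: ifP; lia.
- by move=> l m l_in m_out; rewrite hecke_perm_J1; [repeat case: ifP; lia | lia].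
by lia.
Qed.

(** Three decreasing runs: A positions with n, ..., B+C, then C positions with C-1, ..., 0, then B
    positions with B+C-1, ..., C kept from [E2]. *)
Lemma hecke_perm_J21 k : k <= n -> hecke_perm (E2 * E1)%g k =
  if k < A then n - k else if k < A + C then A + C - 1 - k else n + C - k.
Proof.
move=> le_kn; have [lt_k|ge_k] := ltnP k (A + C); last first.
  rewrite ifF; last by lia.
  by rewrite sort_out; [rewrite hecke_perm_J2 // ifF //; lia | lia].
apply: (@sort_in 0 _ E2 (fun k => if k < A then n - k else A + C - 1 - k)) => //.
- by lia.
- by move=> l; repeat case: ifP; lia.
- by move=> l; repeat case: ifP; lia.
- by move=> l m l_in m_out; rewrite hecke_perm_J2; [repeat case: ifP; lia | lia].
by lia.
Qed.

(** The last factor leaves the positions from A+C on alone. In [E1 * E2] the entries are final from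
    B+C on, which suffices when [B <= A]. *)
Lemma longest121 : B <= A -> (E1 * E2 * E1)%g = longest_hecke [set: 'I_n]%SET.
Proof.
move=> le_BA; apply: hecke_perm_eq => k le_kn; rewrite hecke_permT //.
have [lt_k|ge_k] := ltnP k (A + C); last first.
  by rewrite sort_out; [rewrite hecke_perm_J12 // !ifF //; lia | lia].
apply: (@sort_in 0 _ _ (fun k => n - k)); try lia.
by move=> l m l_in m_out; rewrite hecke_perm_J12; [repeat case: ifP; lia | lia].
Qed.

(** The last factor leaves the first C positions alone, and in [E2 * E1] the first A entries are
    final. *)
Lemma longest212 : C <= A -> (E2 * E1 * E2)%g = longest_hecke [set: 'I_n]%SET.
Proof.
move=> le_CA; apply: hecke_perm_eq => k le_kn; rewrite hecke_permT //.
have [lt_k|ge_k] := ltnP k C.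
  by rewrite sort_out; [rewrite hecke_perm_J21 // ifT //; lia | lia].
apply: (@sort_in C n _ (fun k => n - k)); try lia.
by move=> l m l_in m_out; rewrite hecke_perm_J21; [repeat case: ifP; lia | lia].
Qed.

Lemma interval_cover : (A_interval n 1 (A + C - 1) :|: A_interval n C.+1 n = [set: 'I_n])%SET.
Proof. by apply/setP => i; rewrite !inE; have := ltn_ord i; lia. Qed.

Lemma braid_sizes : (E1 * E2 * E1 = E2 * E1 * E2)%g -> B <= A /\ C <= A.
Proof.
move=> braid; pose z := (E1 * E2 * E1)%g.
(* The form ending in [E1] gives the descents on the left and the form ending in [E2] those on the
   right, so [z] is the longest element. *)
have desc_z k : k < n -> hecke_perm z k.+1 < hecke_perm z k.
  move=> lt_kn; have [lt_k|ge_k] := ltnP k (A + C - 1); first by apply: sort_desc; lia.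
  by rewrite /z braid; apply: sort_desc; lia.
have zE : z = longest_hecke [set: 'I_n]%SET.
  rewrite -[z]hecke_wordK; apply: absorbs_uniq; first by apply/allP => i; rewrite inE.
  by rewrite hecke_wordK; apply/absorbsP => i _; apply: desc_z.
split.
  (* If A < B, the first position untouched by the last [E1] holds n - A instead of n - A - C. *)
  have := hecke_permT (k := A + C); rewrite -zE sort_out; last by lia.
  by rewrite hecke_perm_J12; [repeat case: ifP; lia | lia].
rewrite leqNgt; apply/negP => lt_AC.
(* If A < C, position A is untouched by the last [E2] and holds C - 1 instead of n - A. *)
have := hecke_permT (k := A); rewrite -zE /z braid sort_out; last by lia.
by rewrite hecke_perm_J21; [repeat case: ifP; lia | lia].
Qed.

End Sorting.

(** * The homomorphisms psi *)

Local Notation o0 := (@ord0 1).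
Local Notation o1 := (@ord_max 1).

Lemma ord2P (i : 'I_2) : i = o0 \/ i = o1.
Proof.
by case: i => [[|[|//]] lt_i]; [left | right]; apply: val_inj.
Qed.

Lemma set_ord2P (K : {set 'I_2}) :
  [\/ K = finset.set0, K = [set o0]%SET, K = [set o1]%SET | K = [set: 'I_2]%SET].
Proof.
case K0: (o0 \in K); case K1: (o1 \in K); [apply: Or44 | apply: Or42 | apply: Or43 | apply: Or41];
  apply/setP => i; case: (ord2P i) => ->; rewrite !inE ?K0 ?K1 //.
Qed.

Lemma longest_hecke_set0 n : longest_hecke (finset.set0 : {set 'I_n}) = 1%g.
Proof. by symmetry; apply: (@absorbs_uniq n _ [::]) => // j; rewrite inE. Qed.

Lemma longest_hecke_set1 n (i : 'I_n) : longest_hecke [set i]%SET = hecke_gen (A_ n) i.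
Proof.
symmetry; apply: (@absorbs_uniq n _ [:: i]) => [|j]; first by rewrite /= inE eqxx.
by rewrite inE => /eqP ->; apply: hecke_gen_idem.
Qed.

Lemma cox_perm_longest n (J : {set 'I_n}) :
  cox_perm (longest (A_ n) J) = hecke_perm (longest_hecke J).
Proof. by rewrite hecke_perm_to_hecke. Qed.

Lemma cox_perm_longest1 n (i : 'I_n) : cox_perm (longest (A_ n) [set i]%SET) = swap i id.
Proof.
by rewrite cox_perm_longest longest_hecke_set1 hecke_permE /= /bubble ltnSn.
Qed.

Lemma to_hecke1 n : to_hecke (1%g : coxeter (A_ n)) = 1%g.
Proof. by apply: hecke_perm_inj; rewrite hecke_perm_to_hecke cox_perm1 hecke_perm1. Qed.

Lemma rel_longest_set0 n (K : {set 'I_n}) :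
  to_hecke (rel_longest (A_ n) finset.set0 K) = longest_hecke K.
Proof.
apply: hecke_perm_inj; rewrite !hecke_perm_to_hecke cox_permM cox_perm_longest.
by rewrite longest_hecke_set0 hecke_perm1.
Qed.

Lemma rel_longest_id n (K : {set 'I_n}) : to_hecke (rel_longest (A_ n) K K) = 1%g.
Proof. by rewrite /rel_longest longest_sqr to_hecke1. Qed.

Lemma rel_longestT n (J : {set 'I_n}) k : k <= n ->
  hecke_perm (to_hecke (rel_longest (A_ n) J [set: 'I_n]%SET)) k =
  cox_perm (longest (A_ n) J) (n - k).
Proof.
move=> le_kn; rewrite hecke_perm_to_hecke cox_permM /=.
by rewrite (cox_perm_longest [set: 'I_n]%SET) hecke_permT.
Qed.

(** * The six elements of the Hecke monoid of type A_2 *)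

Section A2.
Local Notation s := (hecke_gen (A_ 2) o0).
Local Notation t := (hecke_gen (A_ 2) o1).

Lemma A2_braid : (s * t * s = t * s * t)%g.
Proof.
rewrite /hecke_gen -!hecke_wordM /=; apply/word_classP/congr_base.
exact: (@hecke_braid _ (A_ 2) o0 o1 3 isT erefl).
Qed.

(** The six listed elements are stable under right multiplication by the generators. *)
Lemma A2_cases (P : hecke (A_ 2) -> Prop) :
  P 1%g -> P s -> P t -> P (s * t)%g -> P (t * s)%g -> P (s * t * s)%g ->
  forall x, P x.
Proof.
move=> P1 Ps Pt Pst Pts Psts x; rewrite -[x]hecke_wordK.
suff : hecke_word (A_ 2) (word_repr x) \in [:: 1; s; t; s * t; t * s; s * t * s]%g.
  by rewrite !inE => /or4P[/eqP->|/eqP->|/eqP->|/or3P[]/eqP->].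
have ss := hecke_gen_idem (A_ 2) o0; have tt := hecke_gen_idem (A_ 2) o1.
have sst : (s * (s * t) = s * t)%g by rewrite mulgA ss.
elim/last_ind: (word_repr x) => [|u i IH]; first by rewrite inE eqxx.
rewrite -cats1 hecke_wordM; case: (ord2P i) => ->; move: IH; rewrite -!/(hecke_gen _ _) !inE.
  case/or4P=> [/eqP->|/eqP->|/eqP->|/or3P[]/eqP->];
    by rewrite ?mul1g -?mulgA ?ss ?eqxx ?orbT.
case/or4P=> [/eqP->|/eqP->|/eqP->|/or3P[]/eqP->].
- by rewrite mul1g eqxx ?orbT.
- by rewrite eqxx ?orbT.
- by rewrite tt eqxx ?orbT.
- by rewrite -mulgA tt eqxx ?orbT.
- by rewrite -A2_braid eqxx ?orbT.
- by rewrite A2_braid -!mulgA tt !mulgA -A2_braid eqxx ?orbT.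
Qed.

Lemma A2_rel_longest0 :
  to_hecke (rel_longest (A_ 2) [set o0]%SET [set: 'I_2]%SET) = (t * s)%g.
Proof.
apply: hecke_perm_eq => k le_k; rewrite rel_longestT // cox_perm_longest1.
by rewrite /hecke_gen -hecke_wordM hecke_permE; case: k le_k => [|[|[|]]].
Qed.

Lemma A2_rel_longest1 :
  to_hecke (rel_longest (A_ 2) [set o1]%SET [set: 'I_2]%SET) = (s * t)%g.
Proof.
apply: hecke_perm_eq => k le_k; rewrite rel_longestT // cox_perm_longest1.
by rewrite /hecke_gen -hecke_wordM hecke_permE; case: k le_k => [|[|[|]]].
Qed.

Lemma A2_longestT : longest_hecke [set: 'I_2]%SET = (s * t * s)%g.
Proof.
apply: hecke_perm_eq => k le_k; rewrite hecke_permT //.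
by rewrite /hecke_gen -!hecke_wordM hecke_permE; case: k le_k => [|[|[|]]].
Qed.

End A2.

Lemma A2_hom_lift n (x y : hecke (A_ n)) :
  (x * x = x)%g -> (y * y = y)%g -> (x * y * x = y * x * y)%g ->
  exists phi : hecke_hom (A_ 2) (A_ n),
    phi (hecke_gen (A_ 2) o0) = x /\ phi (hecke_gen (A_ 2) o1) = y.
Proof.
move=> xx yy xyx.
have [||phi phiE] := @hecke_hom_lift _ _ (A_ 2) (A_ n) (fun i => if i == o0 then x else y).
- by move=> i; case: ifP.
- move=> i j m neq_ij; case: (ord2P i) (ord2P j) neq_ij => [->|->] [->|->] //= _ [<-];
    by rewrite /= !big_cons big_nil /= !mulg1 !mulgA xyx.
by exists phi; rewrite !phiE.
Qed.

Lemma hom_supp1 (I' I : finType) (M' : coxeter_matrix I') (M : coxeter_matrix I)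
  (phi : hecke_hom M' M) i : hom_supp phi [set i]%SET = hecke_supp (phi (hecke_gen M' i)).
Proof. exact: big_set1. Qed.

Lemma hom_supp_ord2 n (phi : hecke_hom (A_ 2) (A_ n)) :
  hom_supp phi [set: 'I_2]%SET =
  (hecke_supp (phi (hecke_gen (A_ 2) o0)) :|: hecke_supp (phi (hecke_gen (A_ 2) o1)))%SET.
Proof.
rewrite /hom_supp; apply/setP => i; apply/bigcupP/setUP => [[j _]|[]].
- by case: (ord2P j) => ->; [left | right].
- by exists o0.
- by exists o1.
Qed.

(** * Injectivity and parabolicity of psi *)

Section Psi.
Variables (n A B C : nat) (psi : hecke_hom (A_ 2) (A_ n)).
Hypotheses (BA : B <= A) (CA : C <= A) (B_gt0 : 0 < B) (C_gt0 : 0 < C).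
Hypothesis sumABC : A + B + C = n.+1.

Local Notation J1 := (A_interval n 1 (A + C - 1)).
Local Notation J2 := (A_interval n C.+1 n).

Hypothesis psi0 : psi (hecke_gen (A_ 2) o0) = longest_hecke J1.
Hypothesis psi1 : psi (hecke_gen (A_ 2) o1) = longest_hecke J2.

Let A_gt0 : 0 < A. Proof. by lia. Qed.

Lemma psi121 : (longest_hecke J1 * longest_hecke J2 * longest_hecke J1)%g =
  longest_hecke [set: 'I_n]%SET.
Proof. exact: (longest121 A_gt0 B_gt0 C_gt0 sumABC). Qed.

Lemma hom_supp_psiT : hom_supp psi [set: 'I_2]%SET = [set: 'I_n]%SET.
Proof.
by rewrite hom_supp_ord2 psi0 psi1 !hecke_supp_longest (interval_cover A_gt0 B_gt0 C_gt0 sumABC).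
Qed.

Lemma psi_longest (K : {set 'I_2}) : psi (longest_hecke K) = longest_hecke (hom_supp psi K).
Proof.
case: (set_ord2P K) => ->.
- by rewrite /hom_supp big_set0 !longest_hecke_set0; apply: gmulf1.
- by rewrite hom_supp1 psi0 hecke_supp_longest longest_hecke_set1 psi0.
- by rewrite hom_supp1 psi1 hecke_supp_longest longest_hecke_set1 psi1.
by rewrite hom_supp_psiT A2_longestT !gmulfM psi0 psi1 psi121.
Qed.

(* The images of the six elements are told apart by their values at 0 and at n. *)
Lemma psi_injective : injective psi.
Proof.
pose key x := (hecke_perm (psi x) 0, hecke_perm (psi x) n).
have le0n : 0 <= n by []; have lenn : n <= n by [].
have key1 : key 1%g = (0, n) by rewrite /key gmulf1 hecke_perm1.
have key_s : key (hecke_gen (A_ 2) o0) = (A + C - 1, n).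
  by rewrite /key psi0 !(hecke_perm_J1 A_gt0 B_gt0 C_gt0 sumABC) //; congr (_, _);
    repeat case: ifP; lia.
have key_t : key (hecke_gen (A_ 2) o1) = (0, C).
  by rewrite /key psi1 !(hecke_perm_J2 A_gt0 B_gt0 C_gt0 sumABC) //; congr (_, _);
    repeat case: ifP; lia.
have key_st : key (hecke_gen (A_ 2) o0 * hecke_gen (A_ 2) o1)%g = (A + C - 1, 0).
  by rewrite /key gmulfM psi0 psi1 !(hecke_perm_J12 A_gt0 B_gt0 C_gt0 sumABC) //;
    congr (_, _); repeat case: ifP; lia.
have key_ts : key (hecke_gen (A_ 2) o1 * hecke_gen (A_ 2) o0)%g = (n, C).
  by rewrite /key gmulfM psi0 psi1 !(hecke_perm_J21 A_gt0 B_gt0 C_gt0 sumABC) //;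
    congr (_, _); repeat case: ifP; lia.
have key_sts :
    key (hecke_gen (A_ 2) o0 * hecke_gen (A_ 2) o1 * hecke_gen (A_ 2) o0)%g = (n, 0).
  by rewrite /key !gmulfM psi0 psi1 psi121 !hecke_permT // subn0 subnn.
have keyE := (key1, key_s, key_t, key_st, key_ts, key_sts).
move=> x y /(congr1 (fun z => (hecke_perm z 0, hecke_perm z n))); rewrite -!/(key _).
elim/A2_cases: x; elim/A2_cases: y => //; rewrite !keyE => -[]; lia.
Qed.

Lemma parabolic_psi_sizes : parabolic_hom psi -> B = 1 /\ C = 1.
Proof.
move=> parabolic_psi.
have [|_ [J [_]]] := parabolic_psi [set: 'I_2]%SET (finite_coxeter_A _) [set o1]%SET.
  exact: finset.subsetT.
rewrite hom_supp_psiT A2_rel_longest1 gmulfM psi0 psi1 => eq_J.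
(* The equation forces w_J to fix the first A positions and to exchange the following blocks of
   sizes B and C, keeping the order inside each. Every ascent of w_J is a node outside [J], hence a
   cut. *)
have wJ k : k <= n -> cox_perm (longest (A_ n) J) k =
    if k < A then k else if k < A + B then k + C else k - B.
  move=> le_kn; have := hecke_perm_J12 A_gt0 B_gt0 C_gt0 sumABC (leq_subr k n).
  rewrite eq_J rel_longestT ?leq_subr // subKn // => ->.
  by repeat case: ifP; lia.
have presJ := @longest_preserves n J; have descJ := @longest_desc n J.
have asc_notin (k : 'I_n) :
    cox_perm (longest (A_ n) J) k < cox_perm (longest (A_ n) J) k.+1 -> k \notin J.
  by move=> asc_k; apply/negP => /descJ; lia.
have lt_An : A < n by lia.
have B1 : B = 1.
  have [//|B_gt1] : B = 1 \/ 1 < B by lia.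
  (* An ascent inside the first exchanged block gives a cut after position A, but the entry at A is
     A + C. *)
  have /presJ/(_ A) : Ordinal lt_An \notin J.
    by apply: asc_notin; rewrite /= !wJ; [repeat case: ifP; lia | lia | lia].
  by rewrite /= wJ; [repeat case: ifP; lia | lia].
split=> //; have [//|C_gt1] : C = 1 \/ 1 < C by lia.
have lt_A1n : A.+1 < n by lia.
(* With B = 1 the second exchanged block starts at A+1; its ascent there gives a cut that the entry
   A + C at position A crosses. *)
have /presJ/(_ A) : Ordinal lt_A1n \notin J.
  by apply: asc_notin; rewrite /= !wJ; [repeat case: ifP; lia | lia | lia].
by rewrite /= wJ; [repeat case: ifP; lia | lia].
Qed.

Lemma psi_parabolic : B = 1 -> C = 1 -> parabolic_hom psi.
Proof.
move=> B1 C1 K' _ J' sJK; split; first exact: finite_coxeter_A.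
have [->|neq_JK] := eqVneq J' K'.
  by exists (hom_supp psi K'); rewrite !rel_longest_id gmulf1.
have [->|neq_J0] := eqVneq J' finset.set0.
  by exists finset.set0; rewrite finset.sub0set !rel_longest_set0 psi_longest.
have KT : K' = [set: 'I_2]%SET.
  case: (set_ord2P K') sJK neq_JK => -> //; first by rewrite finset.subset0 (negPf neq_J0).
    by rewrite finset.subset1 (negPf neq_J0) orbF => ->.
  by rewrite finset.subset1 (negPf neq_J0) orbF => ->.
rewrite {}KT hom_supp_psiT in sJK neq_JK *.
have lt_n1 : n.-1 < n by lia.
have lt_0n : 0 < n by lia.
case: (set_ord2P J') neq_J0 neq_JK => ->; rewrite ?eqxx // => _ _.
  (* For B = C = 1 the product [E2 * E1] is the decreasing sequence with the values 0 and 1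
     exchanged. *)
  exists [set Ordinal lt_0n]%SET; split; first exact: finset.subsetT.
  rewrite A2_rel_longest0 gmulfM psi0 psi1; apply: hecke_perm_eq => k le_kn.
  rewrite rel_longestT // cox_perm_longest1 (hecke_perm_J21 A_gt0 B_gt0 C_gt0 sumABC) //.
  by rewrite /swap /adj_transp /=; repeat case: ifP; lia.
(* Here the values n-1 and n are exchanged. *)
exists [set Ordinal lt_n1]%SET; split; first exact: finset.subsetT.
rewrite A2_rel_longest1 gmulfM psi0 psi1; apply: hecke_perm_eq => k le_kn.
rewrite rel_longestT // cox_perm_longest1 (hecke_perm_J12 A_gt0 B_gt0 C_gt0 sumABC) //.
by rewrite /swap /adj_transp /=; repeat case: ifP; lia.
Qed.

End Psi.

(** * Classification *)

Lemma diagram_hom (I : finType) (M : coxeter_matrix I) (s : {perm I}) :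
  (forall i j, M (s i) (s j) = M i j) ->
  exists d : hecke_hom M M, forall i, d (hecke_gen M i) = hecke_gen M (s i).
Proof.
move=> Ms; have prodE i j m :
    (\prod_(k <- alternating i j m) hecke_gen M (s k))%g =
    hecke_word M (alternating (s i) (s j) m).
  have -> : alternating (s i) (s j) m = map s (alternating i j m).
    by rewrite /alternating /mkseq -map_comp; apply: eq_map => k /=; case: odd.
  elim: (alternating i j m) => [|k u IH]; first by rewrite big_nil.
  by rewrite big_cons IH -hecke_wordM.
apply: hecke_hom_lift => [i|i j m neq_ij Mij]; first exact: hecke_gen_idem.
rewrite !prodE; apply/word_classP/congr_base/hecke_braid; last by rewrite Ms.
by rewrite (inj_eq perm_inj).
Qed.

Lemma diagram_hom_longest n (s : {perm 'I_n}) (d : hecke_hom (A_ n) (A_ n)) J :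
  (forall i, d (hecke_gen (A_ n) i) = hecke_gen (A_ n) (s i)) ->
  d (longest_hecke J) = longest_hecke (s @: J)%SET.
Proof.
move=> dE; have [u u_J uE] := longest_hecke_word J.
have dwE v : d (hecke_word (A_ n) v) = hecke_word (A_ n) (map s v).
  rewrite hecke_hom_word; elim: v => [|i v IH]; first by rewrite big_nil.
  by rewrite big_cons IH dE -hecke_wordM.
rewrite -uE dwE; apply: absorbs_uniq.
  by apply/allP => _ /mapP[i /(allP u_J) i_J ->]; apply: imset_f.
by move=> _ /imsetP[i i_J ->]; rewrite -dwE -dE -gmulfM uE longest_hecke_absorbs.
Qed.

(** The boolean lets one argument treat the identity and the flip together. *)
Definition A_flip (n : nat) (b : bool) : {perm 'I_n} :=
  if b then perm (@rev_ord_inj n) else 1%g.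

Lemma A_flipE n b i : A_flip n b i = if b then rev_ord i else i.
Proof. by rewrite /A_flip; case: b; rewrite ?permE // perm1. Qed.

Lemma A_flip_diag n b i j : A_ n (A_flip n b i) (A_flip n b j) = A_ n i j.
Proof.
rewrite !A_flipE; case: b => //; rewrite /= /A_entry (inj_eq rev_ord_inj) /=.
case: eqP => // neq_ij; congr (Some (if _ then _ else _)).
by have := ltn_ord i; have := ltn_ord j; lia.
Qed.

Lemma A_flip_interval n a b : 0 < a -> b <= n ->
  (A_flip n true @: A_interval n a b = A_interval n (n.+1 - b) (n.+1 - a))%SET.
Proof.
move=> a_gt0 le_bn; apply/setP => i; apply/imsetP/idP => [[j + ->]|].
  by rewrite A_flipE !inE /=; have := ltn_ord j; lia.
rewrite inE => i_ab; exists (rev_ord i); last by rewrite A_flipE rev_ordK.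
by rewrite inE /=; have := ltn_ord i; lia.
Qed.

Definition convex_set (n : nat) (J : {set 'I_n}) : Prop :=
  forall i j k : 'I_n, i \in J -> j \in J -> i <= k <= j -> k \in J.

(** A node missing from [J] separates: no edge inside [J] joins a smaller node to a larger one. *)
Lemma connected_convex n (J : {set 'I_n}) : connected_set (A_ n) J -> convex_set J.
Proof.
move=> /forall_inP conn_J i j k i_J j_J /andP[le_ik le_kj].
apply/negPn/negP => k_J; have /forall_inP/(_ j j_J) := conn_J i i_J.
have neq_k l : l \in J -> l != k :> nat by move=> l_J; apply: contraNneq k_J => /val_inj <-.
set e := [rel x y | _] => conn_ij.
have closed_k : closed e [pred l : 'I_n | l <= k].
  move=> x y /and3P[/neq_k neq_xk /neq_k neq_yk]; rewrite /cox_edge /= /A_entry !inE.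
  by case: ifP => // _; case: ifP => // edge_xy _; lia.
have := closed_connect closed_k conn_ij; rewrite !inE le_ik.
by have := neq_k _ j_J; lia.
Qed.

Lemma convex_cover n (J K : {set 'I_n}) (i0 : 'I_n) : i0 = 0 :> nat ->
  convex_set J -> convex_set K -> (J :|: K = [set: 'I_n])%SET ->
  J != [set: 'I_n]%SET -> K != [set: 'I_n]%SET -> i0 \in J ->
  exists p q, [/\ J = A_interval n 1 p, K = A_interval n q.+1 n, 0 < q, q <= p & p < n].
Proof.
move=> i0_0 conv_J conv_K JK J_neqT K_neqT i0_J.
have proper_ex (L : {set 'I_n}) : L != [set: 'I_n]%SET -> exists k, k \notin L.
  move=> L_neqT; apply/existsP; apply: contraNT L_neqT; rewrite negb_exists => /forallP L_T.
  by apply/eqP/setP => k; rewrite !inE; apply/negPn/L_T.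
have JorK k : k \in J \/ k \in K by apply/orP; rewrite -finset.in_setU JK inE.
(* Otherwise both sets are initial segments, one contains the other, and the larger one is
   everything. *)
have i0_K : i0 \notin K.
  apply/negP => i0_K; have [k k_J] := proper_ex J J_neqT.
  have [l l_K] := proper_ex K K_neqT.
  have {}k_K : k \in K by case: (JorK k) => // k_J'; rewrite k_J' in k_J.
  have l_J : l \in J by case: (JorK l) => // l_K'; rewrite l_K' in l_K.
  case: (leqP k l) => [le_kl|lt_lk].
    by case/negP: k_J; apply: conv_J i0_J l_J _; lia.
  by case/negP: l_K; apply: conv_K i0_K k_K _; lia.
have [k0 k0_J] := proper_ex J J_neqT.
(* [p] is the least ordinal outside [J], which is the number of the last node of [J] counted from 1;
   [q] will be the least ordinal in [K]. *)
case: (@arg_minnP _ k0 (fun k => k \notin J) val k0_J) => p p_J min_p.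
have p_K : p \in K by case: (JorK p) => // p_J'; rewrite p_J' in p_J.
case: (@arg_minnP _ p (fun k => k \in K) val p_K) => q q_K min_q.
have ge_pK (k : 'I_n) : p <= k -> k \in K.
  move=> le_pk; case: (JorK k) => // k_J.
  by case/negP: p_J; apply: conv_J i0_J k_J _; lia.
exists p, q; split=> //; last exact: (min_q p p_K).
- apply/setP => k; rewrite inE /=; apply/idP/idP => [k_J|lt_kp].
    rewrite ltnNge; apply/negP => le_pk.
    by case/negP: p_J; apply: conv_J i0_J k_J _; lia.
  by apply: contraLR lt_kp => /min_p /=; lia.
- apply/setP => k; rewrite inE ltnS; apply/idP/andP => [k_K|[le_qk _]].
    by split; [exact: (min_q k k_K) | exact: ltn_ord].
  have [/ge_pK //|/ltnW le_kp] := leqP p k.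
  by apply: conv_K q_K p_K _; rewrite le_qk.
- rewrite lt0n; apply: contraNneq i0_K => q0.
  by rewrite (_ : i0 = q) //; apply: val_inj; rewrite /= q0.
Qed.

Lemma J_E n A B C (i : 'I_2) : A + B + C = n.+1 ->
  J_ n (A, B, C) i = if i == o0 then A_interval n 1 (A + C - 1) else A_interval n C.+1 n.
Proof. by move=> sumABC; rewrite /J_ sumABC addn1 (subn1 n.+1). Qed.

Lemma psi_exists n l : partitions3 n.+1 l -> exists psi : hecke_hom (A_ 2) (A_ n), is_psi l psi.
Proof.
case: l => [[A B] C] /and4P[BA CB C_gt0 /eqP sumABC].
have A_gt0 : 0 < A by lia.
have B_gt0 : 0 < B by lia.
have CA : C <= A by lia.
have [||| psi [psi0 psi1]] := @A2_hom_lift n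
  (longest_hecke (A_interval n 1 (A + C - 1))) (longest_hecke (A_interval n C.+1 n)).
- exact: longest_hecke_sub.
- exact: longest_hecke_sub.
- by rewrite (longest121 A_gt0 B_gt0 C_gt0 sumABC) // (longest212 A_gt0 B_gt0 C_gt0 sumABC).
by exists psi => i; rewrite J_E //; case: (ord2P i) => ->.
Qed.

(** [braid_sizes] makes A the largest of the three sizes. If the other two are in the wrong order,
    flipping both diagrams exchanges them. *)
Lemma braid_partition n (J K : {set 'I_n}) (i0 : 'I_n) : i0 = 0 :> nat ->
  convex_set J -> convex_set K -> (J :|: K = [set: 'I_n])%SET ->
  J != [set: 'I_n]%SET -> K != [set: 'I_n]%SET -> i0 \in J ->
  (longest_hecke J * longest_hecke K * longest_hecke J =
   longest_hecke K * longest_hecke J * longest_hecke K)%g ->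
  exists l b, [/\ partitions3 n.+1 l, J = (A_flip n b @: J_ n l (A_flip 2 b o0))%SET
    & K = (A_flip n b @: J_ n l (A_flip 2 b o1))%SET].
Proof.
move=> i0_0 conv_J conv_K JK J_neqT K_neqT i0_J.
have [p [q [-> -> q_gt0 le_qp lt_pn]]] := convex_cover i0_0 conv_J conv_K JK J_neqT K_neqT i0_J.
(* The third size C is [q], and the overlap of the two intervals has A - 1 nodes. *)
pose A := p.+1 - q; pose B := n - p.
have sumABC : A + B + q = n.+1 by lia.
have sumACB : A + q + B = n.+1 by lia.
have -> : p = A + q - 1 by lia.
have A_gt0 : 0 < A by lia.
have B_gt0 : 0 < B by lia.
case/(braid_sizes A_gt0 B_gt0 q_gt0 sumABC) => BA qA.
have [le_qB|lt_Bq] := leqP q B.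
  exists (A, B, q), false; rewrite !A_flipE !J_E //= /A_flip !imset_perm1.
  by split=> //; rewrite BA le_qB q_gt0 sumABC eqxx.
exists (A, q, B), true; rewrite !A_flipE !J_E //=.
rewrite !A_flip_interval //; last by lia.
split; first by rewrite qA ltnW // B_gt0 sumACB eqxx.
  by congr A_interval; lia.
by congr A_interval; lia.
Qed.

(** The two booleans are independent, since interchanging the generators costs a further flip of the
    domain only. *)
Lemma psi_up_to_flip n l (phi : hecke_hom (A_ 2) (A_ n)) (b' b : bool) :
  partitions3 n.+1 l ->
  (forall i, phi (hecke_gen (A_ 2) i) = longest_hecke (A_flip n b @: J_ n l (A_flip 2 b' i))%SET) ->
  exists l : nat * nat * nat, partitions3 n.+1 l /\
  exists psi : hecke_hom (A_ 2) (A_ n), is_psi l psi /\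
  exists (d' : hecke_hom (A_ 2) (A_ 2)) (d : hecke_hom (A_ n) (A_ n)),
  [/\ diagram_automorphism d', diagram_automorphism d & forall x, phi x = d (psi (d' x))].
Proof.
move=> l_part phiE; exists l; split=> //.
have [psi psiE] := psi_exists l_part; exists psi; split=> //.
have [d' d'E] := diagram_hom (@A_flip_diag 2 b').
have [d dE] := diagram_hom (@A_flip_diag n b).
exists d', d; split; first by exists (A_flip 2 b'); split=> //; apply: A_flip_diag.
  by exists (A_flip n b); split=> //; apply: A_flip_diag.
move=> x; rewrite -[x]hecke_wordK !hecke_hom_word; elim: (word_repr x) => [|i u IH].
  by rewrite !big_nil !gmulf1.
by rewrite !big_cons !gmulfM -IH phiE d'E psiE -/(longest_hecke _) (diagram_hom_longest _ dE).
Qed.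

Theorem proposition5p2 (n : nat) (hn : (2 <= n)%N) :
  (forall l : nat * nat * nat, partitions3 n.+1 l ->
     exists psi : hecke_hom (A_ 2) (A_ n),
       [/\ is_psi l psi,
           injective psi
         & parabolic_hom psi <-> l = (n.-1, 1%N, 1%N)])
  /\
  (forall phi : hecke_hom (A_ 2) (A_ n),
     injective phi -> connected_hom phi -> fully_supported phi ->
     exists l : nat * nat * nat, partitions3 n.+1 l /\
     exists psi : hecke_hom (A_ 2) (A_ n),
       is_psi l psi /\
     exists (d' : hecke_hom (A_ 2) (A_ 2))
            (d : hecke_hom (A_ n) (A_ n)),
       [/\ diagram_automorphism d', diagram_automorphism d
         & forall x, phi x = d (psi (d' x))]).
Proof.
split=> [[[A B] C] l_part|phi inj_phi conn_phi full_phi].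
  have [psi psiE] := psi_exists l_part; exists psi.
  have /and4P[BA CB C_gt0 /eqP sumABC] := l_part.
  have B_gt0 : 0 < B by lia.
  have CA : C <= A by lia.
  have psi0 : psi (hecke_gen (A_ 2) o0) = longest_hecke (A_interval n 1 (A + C - 1)).
    by rewrite psiE J_E.
  have psi1 : psi (hecke_gen (A_ 2) o1) = longest_hecke (A_interval n C.+1 n).
    by rewrite psiE J_E.
  split=> //; first exact: (psi_injective BA CA B_gt0 C_gt0 sumABC psi0 psi1).
  split=> [para|[eA eB eC]]; last exact: (psi_parabolic BA CA B_gt0 C_gt0 sumABC psi0 psi1).
  have [B1 C1] := parabolic_psi_sizes BA CA B_gt0 C_gt0 sumABC psi0 psi1 para.
  by rewrite B1 C1; congr (_, _, _); lia.
pose s := hecke_gen (A_ 2) o0; pose t := hecke_gen (A_ 2) o1.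
pose J := hecke_supp (phi s); pose K := hecke_supp (phi t).
have phi_s : phi s = longest_hecke J.
  by apply: hecke_idem_longest; rewrite -gmulfM hecke_gen_idem.
have phi_t : phi t = longest_hecke K.
  by apply: hecke_idem_longest; rewrite -gmulfM hecke_gen_idem.
have connected1 (i : 'I_2) : connected_set (A_ 2) [set i]%SET.
  apply/forall_inP => j /set1P->; apply/forall_inP => k /set1P->.
  exact: connect0.
have conv_J : convex_set J.
  by apply: connected_convex; rewrite /J -hom_supp1; apply: conn_phi.
have conv_K : convex_set K.
  by apply: connected_convex; rewrite /K -hom_supp1; apply: conn_phi.
have JK : (J :|: K = [set: 'I_n])%SET by rewrite -full_phi hom_supp_ord2.
(* If [J] were everything, [phi s] would absorb [phi t], and injectivity would give s t = s although
   t occurs on one side only. *)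
have J_neqT : J != [set: 'I_n]%SET.
  apply/eqP => JT; have : phi (s * t)%g = phi s.
    rewrite [RHS]phi_s -(@longest_hecke_sub _ K) ?JT ?finset.subsetT // -JT.
    by rewrite -phi_s -phi_t gmulfM.
  by move/inj_phi; rewrite -hecke_wordM => /hecke_letters/(_ o1).
have K_neqT : K != [set: 'I_n]%SET.
  apply/eqP => KT; have : phi (t * s)%g = phi t.
    rewrite [RHS]phi_t -(@longest_hecke_sub _ J) ?KT ?finset.subsetT // -KT.
    by rewrite -phi_s -phi_t gmulfM.
  by move/inj_phi; rewrite -hecke_wordM => /hecke_letters/(_ o0).
have braid : (longest_hecke J * longest_hecke K * longest_hecke J =
    longest_hecke K * longest_hecke J * longest_hecke K)%g.
  by rewrite -phi_s -phi_t -!gmulfM A2_braid.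
have n_gt0 : 0 < n by lia.
pose i0 : 'I_n := Ordinal n_gt0.
have /setUP[i0_J|i0_K] : i0 \in (J :|: K)%SET by rewrite JK inE.
  have [//|l [b [l_part JE KE]]] :=
    @braid_partition n J K i0 _ conv_J conv_K JK J_neqT K_neqT i0_J braid.
  apply: (@psi_up_to_flip n l phi b b l_part) => i.
  by case: (ord2P i) => ->; rewrite ?phi_s ?phi_t -?JE -?KE.
have [//||l [b [l_part KE JE]]] :=
  @braid_partition n K J i0 _ conv_K conv_J _ K_neqT J_neqT i0_K (esym braid).
  by rewrite finset.setUC.
(* The first node lies in [K], so [K] and [J] trade roles; this amounts to one more flip of the
   domain. *)
have flipC i : A_flip 2 (~~ b) i = A_flip 2 b (rev_ord i).
  by rewrite !A_flipE; case: b {KE JE} => //=; rewrite rev_ordK.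
apply: (@psi_up_to_flip n l phi (~~ b) b l_part) => i; rewrite flipC.
case: (ord2P i) => ->; rewrite ?phi_s ?phi_t.
  by rewrite JE; congr (longest_hecke (_ @: J_ _ _ (A_flip _ _ _))%SET); apply: val_inj.
by rewrite KE; congr (longest_hecke (_ @: J_ _ _ (A_flip _ _ _))%SET); apply: val_inj.
Qed.
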